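(* There exist absolute constants $c > 0$ and $m_0$ such that every finite simple graph $G$ with $m \geq m_0$ edges satisfies $$s^+(G) \geq c\,\frac{m^{6/7}}{(\log\log m)^{8/3}} \quad\text{and}\quad s^-(G) \geq c\, m^{1/2}.$$ Moreover, both exponents are tight: there exist an absolute constant $C$ and graphs $G$ with arbitrarily large number of edges $m$ satisfying $s^+(G) \leq C m^{6/7}$, and graphs $G$ with arbitrarily large number of edges $m$ satisfying $s^-(G) \leq C m^{1/2}$.
   Context: For a finite simple graph $G$ with adjacency matrix eigenvalues $\lambda_1 \geq \cdots \geq \lambda_n$, $s^+(G) = \sum_{i:\lambda_i \geq 0} \lambda_i^2$ and $s^-(G) = \sum_{i:\lambda_i \leq 0} \lambda_i^2$. *)

(* Defs.v *)
From mathcomp Require Import all_boot all_order all_algebra.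
From mathcomp Require Import polyrcf complex.
From mathcomp Require Import reals exp.

Set Implicit Arguments.
Unset Strict Implicit.
Unset Printing Implicit Defensive.

Import Order.TTheory GRing.Theory Num.Theory.
Local Open Scope ring_scope.

Record sgraph := SGraph {
  vertex :> finType;
  adj : rel vertex;
  adj_sym : symmetric adj;
  adj_irrefl : irreflexive adj }.

Definition edges (G : sgraph) : {set {set G}} :=
  [set [set p.1; p.2] | p : G * G & adj p.1 p.2].

Definition num_edges (G : sgraph) : nat := #|edges G|.

Definition adj_mx (R : realType) (G : sgraph) : 'M[R]_#|G| :=
  \matrix_(i, j) (adj (enum_val i) (enum_val j))%:R.

(* lambda_1 >= ... >= lambda_n, repeated according to multiplicity: [rootsR]
   lists each real root once, in increasing order, and [mup] is the multiplicity
   of a root.  The lemmas below show that this is the full spectrum: there are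
   exactly #|G| eigenvalues and the characteristic polynomial splits over them. *)
Definition eigenvalues (R : realType) (G : sgraph) : seq R :=
  let p := char_poly (adj_mx R G) in
  flatten [seq nseq (mup x p) x | x <- rev (rootsR p)].

Definition splus (R : realType) (G : sgraph) : R :=
  \sum_(x <- eigenvalues R G | 0 <= x) x ^+ 2.

Definition sminus (R : realType) (G : sgraph) : R :=
  \sum_(x <- eigenvalues R G | x <= 0) x ^+ 2.

Lemma char_poly_conj (F : fieldType) n (P D : 'M[F]_n) : P \in unitmx ->
  char_poly (invmx P *m D *m P) = char_poly D.
Proof.
move=> uP; rewrite /char_poly.
have -> : char_poly_mx (invmx P *m D *m P) =
    map_mx polyC (invmx P) *m char_poly_mx D *m map_mx polyC P.
  rewrite /char_poly_mx mulmxBr mulmxBl !map_mxM; congr (_ - _).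
  by rewrite scalar_mxC -mulmxA -map_mxM mulVmx // map_mx1 mulmx1.
rewrite !det_mulmx mulrC mulrA -det_mulmx -map_mxM mulmxV //.
by rewrite map_mx1 det1 mul1r.
Qed.

Lemma char_poly_sym_split (R : rcfType) n (A : 'M[R]_n) : A^T = A ->
  exists s : seq R, char_poly A = \prod_(x <- s) ('X - x%:P).
Proof.
move=> symA; set f := real_complex R; pose B := map_mx f A.
have hB : B \is hermsymmx.
  apply: realsym_hermsym.
    by apply/is_hermitianmxP; rewrite expr0 scale1r map_mx_id // map_trmx symA.
  by apply/mxOverP => i j; rewrite mxE; apply/complex_realP; exists (A i j).
have /orthomx_spectralP eB := hermitian_normalmx hB.
have /mxOverP rd := hermitian_spectral_diag_real hB.
exists [seq complex.Re (spectral_diag B 0 i) | i <- enum 'I_n].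
apply: (map_poly_inj f); rewrite map_char_poly -/B {1}eB.
rewrite char_poly_conj ?spectral_unit // char_poly_trig ?diag_mx_is_trig //.
rewrite rmorph_prod big_map big_enum; apply: eq_bigr => i _.
by rewrite rmorphB /= map_polyX map_polyC mxE eqxx mulr1n /f /= RRe_real.
Qed.

Lemma char_poly_eigenvalues (R : realType) (G : sgraph) :
  char_poly (adj_mx R G) = \prod_(x <- eigenvalues R G) ('X - x%:P).
Proof.
have [|s eps] := @char_poly_sym_split R _ (adj_mx R G).
  by apply/matrixP => i j; rewrite !mxE adj_sym.
rewrite /eigenvalues big_flatten big_map /=.
under eq_bigr do rewrite big_nseq iter_mulr_1 eps mu_prod_XsubC.
rewrite (perm_big (undup s)); last first.
  rewrite perm_rev uniq_perm ?undup_uniq ?uniq_roots // => x.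
  have p0 : char_poly (adj_mx R G) != 0 by rewrite monic_neq0 ?char_poly_monic.
  have := roots_on_rootsR p0 x; rewrite in_itv /= => <-.
  by rewrite eps root_prod_XsubC mem_undup.
by rewrite eps -big_undup_iterop_count.
Qed.

Lemma size_eigenvalues (R : realType) (G : sgraph) :
  size (eigenvalues R G) = #|G|.
Proof.
by have := size_char_poly (adj_mx R G);
  rewrite char_poly_eigenvalues size_prod_XsubC => -[].
Qed.

Lemma eigenvalues_sorted (R : realType) (G : sgraph) :
  sorted >=%R (eigenvalues R G).
Proof.
rewrite /eigenvalues; set p := char_poly _.
have : sorted >%R (rev (rootsR p)) by rewrite rev_sorted; exact: sorted_roots.
rewrite !sorted_pairwise; [|exact: rev_trans le_trans|exact: rev_trans lt_trans].
elim: (rev _) => //= x s IHs /andP[xs /IHs ps].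
rewrite pairwise_cat ps andbT; apply/andP; split; last first.
  elim: (mup x p) => //= k ->; rewrite andbT.
  by apply/allP => y /nseqP[-> _] /=.
apply/allrelP => y z /nseqP[-> _] /flatten_mapP[t ts /nseqP[-> _]].
by apply: ltW; apply: (allP xs).
Qed.

(* Main.v *)
(** Lower bound for s^+.  Let p_v be the v-th diagonal entry of the square of the
    positive part of A, so that s^+ is the sum of the p_v, and let lam bound the
    spectrum from above.  Since A_vv = 0, (A^2)_vv = deg v and (A^3)_vv >= 0,
    Cauchy-Schwarz for the spectral measure at v gives
    (deg v - p_v)^4 <= lam^2 p_v^3.  Passing to an induced subgraph does not
    increase s^+, so this applies to the subgraph of the vertices of degree at
    most 16^j with lam = 16^j; after summation over the vertices of degree between
    16^(j-1) and 16^j, the bounds add up geometrically in j up to 16^j ~ m^(3/7).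
    Vertices of larger degree are handled with lam = sqrt s^+.  The resulting
    bound s^+ >= m^(6/7) / 100 has no iterated logarithm.

    Lower bound for s^-.  A maximal matching, and stars joining the unmatched
    non-isolated vertices (an independent set) to neighbours, give positive
    semidefinite test matrices showing that at most 3 s^- vertices are
    non-isolated, whence 2 m <= (3 s^-)^2.

    Tightness.  For s^- take complete graphs.  For s^+ take the affine polar graph
    on p^4 points attached to an elliptic quadric: it has degree about p^3, and
    A <= (p - 1) I + ((p - 1) / p^2) J as quadratic forms. *)
Require Import Defs.
From mathcomp Require Import all_boot all_order all_algebra.
From mathcomp Require Import reals exp.
From mathcomp Require Import finfield.
From mathcomp Require Import ring lra.

Set Implicit Arguments.
Unset Strict Implicit.
Unset Printing Implicit Defensive.

Import Order.TTheory GRing.Theory Num.Theory.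
Local Open Scope ring_scope.

(** * Spectral decomposition of real symmetric kernels *)

Lemma row_normsq_gt0 (F : realDomainType) n (v : 'rV[F]_n) :
  v != 0 -> 0 < (v *m v^T) 0 0.
Proof.
move=> v0; rewrite mxE lt_neqAle sumr_ge0 ?andbT; last first.
  by move=> i _; rewrite mxE -expr2 sqr_ge0.
apply: contra v0; rewrite eq_sym psumr_eq0; last first.
  by move=> i _; rewrite mxE -expr2 sqr_ge0.
move/allP=> h; apply/eqP/rowP => i; rewrite mxE; apply/eqP.
by have := h i (mem_index_enum i); rewrite mxE mulf_eq0 orbb.
Qed.

(* Householder reflection; when [w] is the first basis vector the coefficient
   [2 / 0 = 0] makes [Q] the identity. *)
Lemma orthogonal_first_row (F : rcfType) n (w : 'rV[F]_n.+1) :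
  w *m w^T = 1%:M ->
  exists Q : 'M[F]_n.+1,
    [/\ Q^T = Q, Q *m Q = 1%:M & (delta_mx 0 0 : 'rV_n.+1) *m Q = w].
Proof.
move=> w1; pose e : 'rV[F]_n.+1 := delta_mx 0 0; pose z := e - w.
pose s := (z *m z^T) 0 0.
have zz : z *m z^T = s%:M by rewrite -mx11_scalar.
have s0z : s = 0 -> z = 0.
  move=> s0; apply/eqP; apply: contraTT (eqxx s) => /row_normsq_gt0.
  by rewrite -/s s0 ltxx.
pose w0 := w 0 0.
have ew : e *m w^T = w0%:M.
  rewrite [LHS]mx11_scalar; congr (_ %:M).
  by rewrite -rowE !mxE.
have we : w *m e^T = w0%:M by rewrite -[LHS]trmxK trmx_mul trmxK ew tr_scalar_mx.
have ee : e *m e^T = 1%:M.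
  by rewrite [LHS]mx11_scalar -rowE !mxE !eqxx.
have ez : e *m z^T = (1 - w0)%:M.
  by rewrite /z linearB /= mulmxBr ee ew -raddfB.
have sE : s = 2 * (1 - w0).
  have : s%:M = (2 * (1 - w0))%:M :> 'M[F]_1.
    rewrite -zz {1}/z mulmxBl ez /z linearB /= mulmxBr we w1 -!raddfB /=.
    by congr (_ %:M); ring.
  by move/matrixP/(_ 0 0); rewrite !mxE !mulr1n.
exists (1%:M - (2 / s) *: (z^T *m z)); split.
- by rewrite linearB /= tr_scalar_mx linearZ /= trmx_mul trmxK.
- set M := z^T *m z.
  have MM : M *m M = s *: M by rewrite /M -mulmxA (mulmxA z) zz mul_scalar_mx scalemxAr.
  rewrite mulmxBl mul1mx mulmxBr mulmx1 -scalemxAl -scalemxAr MM !scalerA.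
  have -> : 2 / s * (2 / s) * s = 2 / s + 2 / s.
    by have [->|sn0] := eqVneq s 0; [rewrite invr0; ring|field].
  by rewrite scalerDl opprB addrK subrK.
- rewrite mulmxBr mulmx1 -scalemxAr mulmxA ez mul_scalar_mx scalerA.
  have [s0|sn0] := eqVneq s 0.
    have := s0z s0; rewrite /z => /eqP; rewrite subr_eq0 => /eqP <-.
    by rewrite subrr scaler0 subr0.
  have w01 : 1 - w0 != 0 by move: sn0; rewrite sE mulf_eq0 pnatr_eq0.
  by rewrite sE (_ : 2 / _ * _ = 1) ?scale1r ?subKr //; field; rewrite w01.
Qed.

(** Induction on [n]: the characteristic polynomial splits, so there is a unit eigenvector, and a
    reflection taking it to the first basis vector leaves a smaller symmetric block. *)
Lemma sym_orthogonal_diag (F : rcfType) n (A : 'M[F]_n) : A^T = A ->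
  exists (U : 'M[F]_n) (d : 'rV[F]_n),
    U *m U^T = 1%:M /\ A = U^T *m diag_mx d *m U.
Proof.
elim: n A => [|n IHn] A symA.
  by exists 1%:M, 0; split; rewrite ?flatmx0 // [A]flatmx0 [RHS]flatmx0.
have [[|a s] chA] := char_poly_sym_split symA.
  by have := size_char_poly A; rewrite chA big_nil size_poly1.
have /eigenvalueP[v vA v0] : eigenvalue A a.
  by rewrite eigenvalue_root_char chA root_prod_XsubC mem_head.
pose k := Num.sqrt ((v *m v^T) 0 0); pose w := k^-1 *: v.
have kk : k ^+ 2 = (v *m v^T) 0 0 by rewrite sqr_sqrtr // ltW // row_normsq_gt0.
have k0 : k != 0 by rewrite sqrtr_eq0 -ltNge row_normsq_gt0.
have w1 : w *m w^T = 1%:M.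
  rewrite /w linearZ /= -scalemxAl -scalemxAr scalerA [v *m _]mx11_scalar -kk.
  by rewrite scale_scalar_mx; congr (_ %:M); field.
have wA : w *m A = a *: w by rewrite -scalemxAl vA !scalerA mulrC.
have [Q [QT QQ eQ]] := orthogonal_first_row w1.
pose B := Q *m A *m Q.
have symB : B^T = B by rewrite /B !trmx_mul symA QT mulmxA.
have rB : delta_mx 0 0 *m B = a *: (delta_mx 0 0 : 'rV_n.+1).
  by rewrite /B !mulmxA eQ wA -scalemxAl -eQ -mulmxA QQ mulmx1.
have rB0 j : B 0 j = a *+ (j == 0).
  by have /matrixP/(_ 0 j) := rB; rewrite -rowE !mxE eqxx mulr_natr.
have cB0 j : B j 0 = a *+ (j == 0) by rewrite -rB0 -{1}symB mxE.
have [|U [d [UU dE]]] := IHn (drsubmx (B : 'M_(1 + n))).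
  by rewrite trmx_drsub symB.
have AE : A = Q *m B *m Q.
  by rewrite /B !mulmxA QQ mul1mx -mulmxA QQ mulmx1.
clearbody B.
have ul : ulsubmx (B : 'M_(1 + n)) = a%:M.
  by apply/matrixP => i j; rewrite !mxE !ord1 !lshift0 rB0 ?eqxx.
have ur : ursubmx (B : 'M_(1 + n)) = 0.
  by apply/matrixP => i j; rewrite !mxE ord1 !lshift0 rB0.
have dl : dlsubmx (B : 'M_(1 + n)) = 0.
  by apply/matrixP => i j; rewrite !mxE ord1 !lshift0 cB0.
have BE : B = block_mx (a%:M : 'M_1) 0 0 (drsubmx (B : 'M_(1 + n))).
  by rewrite -[LHS](@submxK _ 1 n 1 n B) ul ur dl.
pose V : 'M_(1 + n) := block_mx (1%:M : 'M_1) 0 0 U.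
have VV : V *m V^T = 1%:M.
  rewrite tr_block_mx mulmx_block.
  by rewrite !(mulmx0, mul0mx, trmx0, addr0, add0r, trmx1, mulmx1) UU -scalar_mx_block.
have VdV : V^T *m diag_mx (row_mx (a%:M : 'M_1) d) *m V = B.
  rewrite BE tr_block_mx !trmx0 trmx1 diag_mx_row !mulmx_block.
  rewrite !(mulmx0, mul0mx, addr0, add0r, mulmx1, mul1mx) -dE; congr block_mx.
  by apply/matrixP => i j; rewrite !mxE !ord1.
exists (V *m Q : 'M_n.+1), (row_mx (a%:M : 'M_1) d); split.
  by rewrite trmx_mul QT -mulmxA (mulmxA Q) QQ mul1mx VV.
by rewrite AE -VdV trmx_mul QT !mulmxA.
Qed.

(** * Test kernels and square energies *)

Section Kernels.
Variables (R : realType) (T : finType).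
Implicit Types (a X : T -> T -> R) (d y : T -> R) (x : T -> T -> R).

Lemma sum_delta (I : finType) (y : I -> R) u : \sum_v (u == v)%:R * y v = y u.
Proof.
rewrite (bigD1 u) //= eqxx mul1r big1 ?addr0 // => v.
by rewrite eq_sym => /negPf->; rewrite mul0r.
Qed.

(** Lagrange's identity: twice the difference of the two sides is a sum of squares. *)
Lemma sumM_sqr (I : finType) (P : pred I) (f g : I -> R) :
  (\sum_(i | P i) f i * g i) ^+ 2 <=
  (\sum_(i | P i) f i ^+ 2) * (\sum_(i | P i) g i ^+ 2).
Proof.
have h : 0 <= \sum_(i | P i) \sum_(j | P j) (f i * g j - f j * g i) ^+ 2.
  by apply: sumr_ge0 => i _; apply: sumr_ge0 => j _; rewrite sqr_ge0.
have e : \sum_(i | P i) \sum_(j | P j) (f i * g j - f j * g i) ^+ 2 =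
    2 * ((\sum_(i | P i) f i ^+ 2) * (\sum_(i | P i) g i ^+ 2) -
         (\sum_(i | P i) f i * g i) ^+ 2).
  rewrite expr2 !big_distrlr /=.
  transitivity (\sum_(i | P i) \sum_(j | P j)
      (f i ^+ 2 * g j ^+ 2 + f j ^+ 2 * g i ^+ 2 - 2 * (f i * g i * (f j * g j)))).
    by apply: eq_bigr => i _; apply: eq_bigr => j _; ring.
  under [LHS]eq_bigr do rewrite !big_split /= sumrN.
  rewrite !big_split /= sumrN.
  under [X in _ - X]eq_bigr do rewrite -mulr_sumr.
  by rewrite -mulr_sumr [X in _ + X - _]exchange_big /=; ring.
by rewrite e pmulr_rge0 ?subr_ge0 in h.
Qed.

(** Expand the squared distance from [f] to its projection on the span of the [e i]. *)
Lemma bessel (I P : finType) (e : I -> P -> R) (f : P -> R) :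
  (forall i j, \sum_p e i p * e j p = (i == j)%:R) ->
  \sum_i (\sum_p f p * e i p) ^+ 2 <= \sum_p f p ^+ 2.
Proof.
move=> orth.
have [z zE] : exists z : I -> R, forall i, z i = \sum_p f p * e i p by eexists.
under eq_bigr do rewrite -zE.
have h : 0 <= \sum_p (f p - \sum_i z i * e i p) ^+ 2.
  by apply: sumr_ge0 => p _; rewrite sqr_ge0.
suff e1 : \sum_p (f p - \sum_i z i * e i p) ^+ 2 = \sum_p f p ^+ 2 - \sum_i z i ^+ 2.
  by rewrite e1 subr_ge0 in h.
have c1 : \sum_p f p * (\sum_i z i * e i p) = \sum_i z i ^+ 2.
  under eq_bigr do rewrite mulr_sumr.
  rewrite exchange_big /=; apply: eq_bigr => i _.
  by rewrite expr2 [X in _ = _ * X]zE mulr_sumr; apply: eq_bigr => p _; ring.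
have c2 : \sum_p (\sum_i z i * e i p) ^+ 2 = \sum_i z i ^+ 2.
  under eq_bigr do rewrite expr2 big_distrlr /=.
  rewrite exchange_big /=; apply: eq_bigr => i _.
  rewrite exchange_big /= expr2 -[X in _ = _ * X](sum_delta z i) mulr_sumr.
  apply: eq_bigr => j _; rewrite -orth mulr_suml mulr_sumr.
  by apply: eq_bigr => p _; ring.
transitivity (\sum_p (f p ^+ 2 - 2 * (f p * (\sum_i z i * e i p)) 
  + (\sum_i z i * e i p) ^+ 2)).
  by apply: eq_bigr => p _; ring.
by rewrite big_split sumrB -mulr_sumr c1 c2 /=; ring.
Qed.

Definition quad X y := \sum_u \sum_v X u v * (y u * y v).
Definition psd X := forall y, 0 <= quad X y.
Definition inner a X := \sum_u \sum_v a u v * X u v.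
Definition frob X := \sum_u \sum_v X u v ^+ 2.
Definition pos_sqr d := \sum_(i | 0 <= d i) d i ^+ 2.

(** The eigenvectors are the rows [x i], indexed by [T] itself. Row orthonormality feeds Bessel's
    inequality; column orthonormality makes [x i v ^+ 2] a probability measure in [i], the spectral
    measure at [v]. *)
Definition spectral a d x :=
  [/\ forall i j, \sum_v x i v * x j v = (i == j)%:R,
      forall u v, \sum_i x i u * x i v = (u == v)%:R &
      forall u v, a u v = \sum_i d i * (x i u * x i v)].

Lemma spectralN a d x : spectral a d x ->
  spectral (fun u v => - a u v) (fun i => - d i) x.
Proof.
case=> o1 o2 aE; split=> // u v; rewrite aE -sumrN.
by apply: eq_bigr => i _; rewrite mulNr.
Qed.

(** The rank-one matrices of the [x i] are orthonormal for the trace inner product, and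
    [quad X (x i)] is the coefficient of [X] along the [i]-th. *)
Lemma bessel_quad a d x X : spectral a d x -> \sum_i quad X (x i) ^+ 2 <= frob X.
Proof.
case=> o1 _ _.
have := @bessel T (T * T)%type (fun i p => x i p.1 * x i p.2) (fun p => X p.1 p.2).
rewrite /quad /frob !pair_bigA /= => h.
under eq_bigr do rewrite pair_bigA /=.
apply: h => i j.
rewrite -(pair_bigA _ (fun u v => x i u * x i v * (x j u * x j v))) /=.
transitivity (\sum_u \sum_v (x i u * x j u) * (x i v * x j v)).
  by apply: eq_bigr => u _; apply: eq_bigr => v _; ring.
by rewrite -big_distrlr /= o1; case: eqP; rewrite ?mulr1 ?mulr0.
Qed.

Lemma inner_spectral a d x X : spectral a d x ->
  inner a X = \sum_i d i * quad X (x i).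
Proof.
case=> _ _ aE; rewrite /inner /quad.
under eq_bigr do under eq_bigr do rewrite aE mulr_suml.
under eq_bigr do rewrite exchange_big.
rewrite exchange_big /=; apply: eq_bigr => i _; rewrite mulr_sumr.
apply: eq_bigr => u _; rewrite mulr_sumr.
by apply: eq_bigr => v _; ring.
Qed.

Lemma quad_eigen a d x i : spectral a d x -> quad a (x i) = d i.
Proof.
case=> o1 _ aE; rewrite /quad.
under eq_bigr do under eq_bigr do rewrite aE mulr_suml.
under eq_bigr do rewrite exchange_big.
rewrite exchange_big /= -[RHS](sum_delta d i); apply: eq_bigr => j _.
transitivity (d j * \sum_u \sum_v (x i u * x j u) * (x i v * x j v)).
  rewrite mulr_sumr; apply: eq_bigr => u _; rewrite mulr_sumr.
  by apply: eq_bigr => v _; ring.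
by rewrite -big_distrlr /= o1 mulrC; case: eqP; rewrite ?mulr1 ?mulr0.
Qed.

(** Negative eigenvalues contribute at most zero against a positive semidefinite [X]; the others are
    handled by Cauchy-Schwarz and Bessel. A good choice of [X] bounds [pos_sqr d] from below. *)
Lemma inner_psd_le a d x X : spectral a d x -> psd X -> 0 <= inner a X ->
  inner a X ^+ 2 <= pos_sqr d * frob X.
Proof.
move=> sa psdX ge0.
have le1 : inner a X <= \sum_(i | 0 <= d i) d i * quad X (x i).
  rewrite (inner_spectral _ sa) (bigID (fun i => 0 <= d i)) /= gerDl.
  apply: sumr_le0 => i; rewrite -ltNge => /ltW di.
  by rewrite mulr_le0_ge0.
apply: le_trans (_ : (\sum_(i | 0 <= d i) d i * quad X (x i)) ^+ 2 <= _).
  by rewrite lerXn2r ?nnegrE // (le_trans ge0).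
apply: le_trans (sumM_sqr _ _ _) _; apply: ler_wpM2l.
  by apply: sumr_ge0 => i _; rewrite sqr_ge0.
apply: le_trans (bessel_quad X sa).
rewrite [leRHS](bigID (fun i => 0 <= d i)) /= lerDl.
by apply: sumr_ge0 => i _; rewrite sqr_ge0.
Qed.

(** Where [0 <= d i], the eigenvalue is at most [quad X (x i)]; Bessel sums the squares. Used for
    the extremal graphs. *)
Lemma pos_sqr_le_frob a d x X : spectral a d x ->
  (forall y, quad a y <= quad X y) -> pos_sqr d <= frob X.
Proof.
move=> sa leX; apply: le_trans (bessel_quad X sa).
rewrite [leRHS](bigID (fun i => 0 <= d i)) /=.
apply: ler_wpDr; first by apply: sumr_ge0 => i _; rewrite sqr_ge0.
apply: ler_sum => i di; rewrite lerXn2r ?nnegrE //.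
  by rewrite (le_trans di) // -(quad_eigen i sa).
by rewrite -(quad_eigen i sa).
Qed.

End Kernels.

(** Moves the diagonalisation from ordinals to vertices. The diagonal agrees with [eigenvalues] up
    to order because both factor the characteristic polynomial; the negative energy is the positive
    one of [-A]. *)
Lemma graph_spectral (R : realType) (G : sgraph) :
  exists (d : G -> R) (x : G -> G -> R),
    [/\ spectral (fun u v => (adj u v)%:R) d x,
        splus R G = pos_sqr d & sminus R G = pos_sqr (fun i => - d i)].
Proof.
have [|U [d [UU AE]]] := @sym_orthogonal_diag R _ (adj_mx R G).
  by apply/matrixP => i j; rewrite !mxE adj_sym.
have UU' : U^T *m U = 1%:M by apply: mulmx1C.
have uU : U \in unitmx by have [] := mulmx1_unit UU.
have reix (f : 'I_#|G| -> R) : \sum_(v : G) f (enum_rank v) = \sum_i f i.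
  by rewrite (reindex enum_rank) //; apply: onW_bij; exact: enum_rank_bij.
have ev : perm_eq (eigenvalues R G) [seq d 0 (enum_rank v) | v <- index_enum G].
  apply: prod_XsubC_eq; rewrite -char_poly_eigenvalues AE.
  have -> : U^T = invmx U by rewrite -[RHS]mul1mx -UU' mulmxK.
  rewrite char_poly_conj // char_poly_trig ?diag_mx_is_trig //.
  rewrite big_map (reindex enum_rank) /=; last by apply: onW_bij; exact: enum_rank_bij.
  by apply: eq_bigr => v _; rewrite !mxE eqxx mulr1n.
exists (fun v => d 0 (enum_rank v)), (fun u v => U (enum_rank u) (enum_rank v)).
split; first split.
- move=> i j; rewrite (reix (fun k => U (enum_rank i) k * U (enum_rank j) k)).
  have /matrixP/(_ (enum_rank i) (enum_rank j)) := UU.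
  rewrite !mxE (inj_eq enum_rank_inj) => <-.
  by apply: eq_bigr => k _; rewrite !mxE.
- move=> u v; rewrite (reix (fun k => U k (enum_rank u) * U k (enum_rank v))).
  have /matrixP/(_ (enum_rank u) (enum_rank v)) := UU'.
  rewrite !mxE (inj_eq enum_rank_inj) => <-.
  by apply: eq_bigr => k _; rewrite !mxE.
- move=> u v; rewrite (reix (fun k => d 0 k * (U k (enum_rank u) * U k (enum_rank v)))).
  have /matrixP/(_ (enum_rank u) (enum_rank v)) := AE.
  rewrite !mxE !enum_rankK => ->; apply: eq_bigr => k _.
  rewrite mul_mx_diag !mxE; ring.
- by rewrite /splus (perm_big _ ev) /= big_map.
- rewrite /sminus (perm_big _ ev) /= big_map; apply: eq_big => [v|v _].
    by rewrite oppr_ge0.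
  by rewrite sqrrN.
Qed.

(** * Local moments and induced subgraphs *)

Section PositivePart.
Variables (R : realType) (T : finType).
Implicit Types (a X : T -> T -> R) (d y : T -> R) (x : T -> T -> R).

Lemma quad_spectral a d x y : spectral a d x ->
  quad a y = \sum_i d i * (\sum_u x i u * y u) ^+ 2.
Proof.
case=> _ _ aE; rewrite /quad.
under eq_bigr do under eq_bigr do rewrite aE mulr_suml.
under eq_bigr do rewrite exchange_big.
rewrite exchange_big /=; apply: eq_bigr => i _; rewrite expr2 big_distrlr /= mulr_sumr.
apply: eq_bigr => u _; rewrite mulr_sumr.
by apply: eq_bigr => v _; ring.
Qed.

Lemma spectral_psd a d x : spectral a d x -> (forall i, 0 <= d i) -> psd a.
Proof.
move=> sa d0 y; rewrite (quad_spectral y sa).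
by apply: sumr_ge0 => i _; rewrite mulr_ge0 ?sqr_ge0.
Qed.

(** The positive part of [a], for which [inner_psd_le] is an equality. *)
Lemma positive_part a d x : spectral a d x ->
  exists K, [/\ psd K, inner a K = pos_sqr d & frob K = pos_sqr d].
Proof.
move=> sa; have [o1 o2 _] := sa.
pose K u v := \sum_i Num.max (d i) 0 * (x i u * x i v).
have sK : spectral K (fun i => Num.max (d i) 0) x by split.
have posE (e : T -> R) : (forall i, e i = if 0 <= d i then d i ^+ 2 else 0) ->
    \sum_i e i = pos_sqr d.
  by move=> eE; rewrite /pos_sqr [RHS]big_mkcond; apply: eq_bigr => i _.
exists K; split.
- by apply: (spectral_psd sK) => i; rewrite le_max lexx orbT.
- rewrite (inner_spectral _ sa); apply: posE => i; rewrite (quad_eigen i sK).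
  by case: (leP 0 (d i)) => // _; rewrite mulr0.
- transitivity (inner K K).
    by apply: eq_bigr => u _; apply: eq_bigr => v _; rewrite expr2.
  rewrite (inner_spectral _ sK); apply: posE => i; rewrite (quad_eigen i sK).
  by case: (leP 0 (d i)) => // _; rewrite mulr0.
Qed.

Lemma weighted_sumM_sqr (I : finType) (P : pred I) (w f g : I -> R) :
  (forall i, P i -> 0 <= w i) ->
  (\sum_(i | P i) w i * (f i * g i)) ^+ 2 <=
  (\sum_(i | P i) w i * f i ^+ 2) * (\sum_(i | P i) w i * g i ^+ 2).
Proof.
move=> w0; have := sumM_sqr P (fun i => Num.sqrt (w i) * f i) (fun i => Num.sqrt (w i) * g i).
rewrite (eq_bigr (fun i => w i * (f i * g i))); last first.
  by move=> i Pi; rewrite -[in RHS](sqr_sqrtr (w0 i Pi)); ring.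
rewrite [X in _ <= X * _](eq_bigr (fun i => w i * f i ^+ 2)); last first.
  by move=> i Pi; rewrite exprMn sqr_sqrtr ?w0.
rewrite [X in _ <= _ * X](eq_bigr (fun i => w i * g i ^+ 2)) // => i Pi.
by rewrite exprMn sqr_sqrtr ?w0.
Qed.

Lemma spectral_eigen a d x i v : spectral a d x ->
  \sum_u a v u * x i u = d i * x i v.
Proof.
case=> o1 _ aE; under eq_bigr do rewrite aE mulr_suml.
rewrite exchange_big /= -(sum_delta (fun j => d j * x j v) i).
apply: eq_bigr => j _; rewrite -o1 mulr_suml.
by apply: eq_bigr => u _; ring.
Qed.

Lemma spectral_sqr a d x v w : spectral a d x ->
  \sum_u a v u * a u w = \sum_i d i ^+ 2 * (x i v * x i w).
Proof.
move=> sa; have [_ _ aE] := sa.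
under eq_bigr do rewrite [X in _ * X]aE mulr_sumr.
rewrite exchange_big /=; apply: eq_bigr => i _.
rewrite [RHS](_ : _ = d i * x i w * (d i * x i v)); last by ring.
by rewrite -(spectral_eigen i v sa) mulr_sumr; apply: eq_bigr => u _; ring.
Qed.

Lemma spectral_cube a d x v w : spectral a d x ->
  \sum_u (\sum_t a v t * a t u) * a u w = \sum_i d i ^+ 3 * (x i v * x i w).
Proof.
move=> sa; have [_ _ aE] := sa.
under eq_bigr do rewrite mulr_suml.
rewrite exchange_big /=.
under eq_bigr do under eq_bigr do rewrite -mulrA.
under eq_bigr do rewrite -mulr_sumr (spectral_sqr _ _ sa) mulr_sumr.
rewrite exchange_big /=; apply: eq_bigr => i _.
rewrite [RHS](_ : _ = d i ^+ 2 * x i w * (d i * x i v)); last by ring.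
by rewrite -(spectral_eigen i v sa) mulr_sumr; apply: eq_bigr => u _; ring.
Qed.

(** The diagonal entry at [v] of the square of the positive part. *)
Definition local_pos d x v := \sum_(i | 0 <= d i) d i ^+ 2 * x i v ^+ 2.

Lemma local_pos_ge0 d x v : 0 <= local_pos d x v.
Proof. by apply: sumr_ge0 => i _; rewrite mulr_ge0 ?sqr_ge0. Qed.

Lemma sum_local_pos a d x : spectral a d x ->
  \sum_v local_pos d x v = pos_sqr d.
Proof.
case=> o1 _ _; rewrite exchange_big /=; apply: eq_bigr => i _.
by rewrite -mulr_sumr (o1 i i) eqxx mulr1.
Qed.

(* With [q i = x i v ^+ 2], the three moments [sum d q = 0], [sum d^2 q = a^2 v v]
   and [sum d^3 q >= 0] bound the negative part of the second moment through
   [N2^2 <= N1 N3], where [N1] and [N3] are controlled by the positive part. *)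
Lemma local_moment a d x v lam : spectral a d x ->
  (forall u w, 0 <= a u w) -> a v v = 0 -> (forall i, d i <= lam) ->
  (\sum_u a v u * a u v - local_pos d x v) ^+ 4 <=
  lam ^+ 2 * local_pos d x v ^+ 3.
Proof.
move=> sa a0 avv dlam; have [o1 o2 aE] := sa.
pose q i := x i v ^+ 2; have q0 i : 0 <= q i by rewrite sqr_ge0.
have q1 : \sum_i q i = 1 by rewrite /q (o2 v v) eqxx.
pose p := local_pos d x v; have p0 : 0 <= p := local_pos_ge0 d x v.
pose N1 := \sum_(i | ~~ (0 <= d i)) (- d i * q i).
pose N2 := \sum_(i | ~~ (0 <= d i)) (d i ^+ 2 * q i).
pose N3 := \sum_(i | ~~ (0 <= d i)) (- d i ^+ 3 * q i).
have e1 : N1 = \sum_(i | 0 <= d i) d i * q i.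
  have : \sum_i d i * q i = 0.
    by rewrite -[RHS]avv aE; apply: eq_bigr => i _; rewrite /q expr2.
  rewrite (bigID (fun i => 0 <= d i)) /= => /eqP; rewrite addr_eq0 => /eqP ->.
  by rewrite -sumrN; apply: eq_bigr => i _; rewrite mulNr.
have e2 : \sum_u a v u * a u v - p = N2.
  rewrite (spectral_sqr _ _ sa) (bigID (fun i => 0 <= d i)) /= addrC.
  by rewrite /p /local_pos /N2 /q addrK; apply: eq_bigr.
have e3 : N3 <= \sum_(i | 0 <= d i) d i ^+ 3 * q i.
  have : 0 <= \sum_i d i ^+ 3 * q i.
    rewrite /q (_ : \sum_i _ = \sum_i d i ^+ 3 * (x i v * x i v)); last first.
      by apply: eq_bigr => i _; rewrite expr2.
    rewrite -(spectral_cube _ _ sa); apply: sumr_ge0 => u _.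
    by rewrite mulr_ge0 // sumr_ge0 // => t _; rewrite mulr_ge0.
  have -> : N3 = - \sum_(i | ~~ (0 <= d i)) d i ^+ 3 * q i.
    by rewrite /N3 -sumrN; apply: eq_bigr => i _; rewrite mulNr.
  by rewrite (bigID (fun i => 0 <= d i)) /= => h; rewrite -subr_ge0 opprK.
have n3 : N3 <= lam * p.
  apply: le_trans e3 _; rewrite mulr_sumr; apply: ler_sum => i di.
  rewrite /q exprS -mulrA; apply: ler_wpM2r; last exact: dlam.
  by apply: mulr_ge0; exact: sqr_ge0.
have N10 : 0 <= N1.
  by apply: sumr_ge0 => i; rewrite -ltNge => /ltW di; rewrite mulr_ge0 ?oppr_ge0.
have N30 : 0 <= N3.
  apply: sumr_ge0 => i; rewrite -ltNge => /ltW di; rewrite mulr_ge0 //.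
  by rewrite oppr_ge0 exprS mulr_le0_ge0 ?sqr_ge0.
(* Cauchy-Schwarz against the constant 1, as [q] has mass at most 1 on the nonnegative
   eigenvalues. *)
have n1 : N1 ^+ 2 <= p.
  rewrite e1.
  have := @weighted_sumM_sqr T (fun i => 0 <= d i) q d (fun _ => 1) (fun i _ => q0 i).
  rewrite (eq_bigr (fun i => d i * q i)); last by move=> i _; rewrite mulr1 mulrC.
  rewrite (eq_bigr (fun i => d i ^+ 2 * x i v ^+ 2) (F1 := fun i => q i * d i ^+ 2));
    last by move=> i _; rewrite mulrC.
  move=> h; apply: le_trans h _; rewrite -/(local_pos d x v) -/p ler_piMr //.
  rewrite -[leRHS]q1 [leRHS](bigID (fun i => 0 <= d i)) /= (eq_bigr q); last first.
    by move=> i _; rewrite expr1n mulr1.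
  by rewrite lerDl sumr_ge0.
have n2 : N2 ^+ 2 <= N1 * N3.
  have := @weighted_sumM_sqr T (fun i => ~~ (0 <= d i)) (fun i => - d i * q i)
    (fun _ => 1) (fun i => - d i).
  rewrite (eq_bigr (fun i => d i ^+ 2 * q i)); last by move=> i _; ring.
  rewrite [X in _ <= X * _](eq_bigr (fun i => - d i * q i)); last by move=> i _; ring.
  rewrite [X in _ <= _ * X](eq_bigr (fun i => - d i ^+ 3 * q i)); last by move=> i _; ring.
  by apply=> i; rewrite -ltNge => /ltW di; rewrite mulr_ge0 ?oppr_ge0.
rewrite e2 -/p (_ : N2 ^+ 4 = (N2 ^+ 2) ^+ 2); last by ring.
apply: le_trans (_ : (N1 * N3) ^+ 2 <= _).
  by rewrite lerXn2r ?nnegrE ?sqr_ge0 ?mulr_ge0.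
rewrite exprMn (_ : _ * p ^+ 3 = p * (lam * p) ^+ 2); last by ring.
apply: ler_pM; rewrite ?sqr_ge0 //.
by rewrite lerXn2r ?nnegrE // (le_trans N30).
Qed.

End PositivePart.

(** The vertex type is kept and vertices outside [P] become isolated. This only adds zero
    eigenvalues to the induced subgraph, and degrees for different [P] stay comparable. *)
Definition restrict (G : sgraph) (P : pred G) : sgraph.
Proof.
refine (@SGraph G (fun u v => [&& P u, P v & adj u v]) _ _).
- by move=> u v; rewrite adj_sym andbCA.
- by move=> u; rewrite adj_irrefl !andbF.
Defined.

Section Graphs.
Variable R : realType.
Implicit Type G : sgraph.

Definition adj_val G (u v : G) : R := (adj u v)%:R.
Definition degree G (v : G) : R := \sum_u adj_val v u.

(* The compression to [P] of the positive part of the subgraph is a test matrix for [G]. *)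
Lemma splus_restrict G (P : pred G) : splus R (restrict P) <= splus R G.
Proof.
have [d [x [sG -> _]]] := graph_spectral R G.
have [d' [x' [sH -> _]]] := graph_spectral R (restrict P).
have [K [psdK aK fK]] := positive_part sH.
pose X (u v : G) := (P u)%:R * (P v)%:R * K u v.
have iX : inner (fun u v => (adj u v)%:R) X = pos_sqr d'.
  rewrite -aK; apply: eq_bigr => u _; apply: eq_bigr => v _.
  rewrite /X /=; case: (P u); case: (P v); case: (adj u v);
    by rewrite /= ?(mul0r, mulr0, mul1r, mulr1).
have fX : frob X <= pos_sqr d'.
  rewrite -fK; apply: ler_sum => u _; apply: ler_sum => v _.
  rewrite /X -natrM mulnb; case: (P u && P v); rewrite ?mul1r // mul0r expr0n sqr_ge0 //.
have psdX : psd X.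
  move=> y; have := psdK (fun u => (P u)%:R * y u); rewrite /quad => h.
  apply: le_trans h _; rewrite le_eqVlt; apply/orP; left; apply/eqP.
  by apply: eq_bigr => u _; apply: eq_bigr => v _; rewrite /X; ring.
have S0 : 0 <= pos_sqr d' by apply: sumr_ge0 => i _; rewrite sqr_ge0.
have := inner_psd_le sG psdX; rewrite iX => /(_ S0) h.
(* The test gives [s'^2 <= s s'] for the energies [s'] of the subgraph and [s] of [G]; divide by
   [s'] when it is nonzero. *)
have [->|n0] := eqVneq (pos_sqr d') 0.
  by apply: sumr_ge0 => i _; rewrite sqr_ge0.
have gt0 : 0 < pos_sqr d' by rewrite lt_neqAle eq_sym n0.
rewrite -(ler_pM2r gt0) -expr2 (le_trans h) // ler_wpM2l //.
by apply: sumr_ge0 => i _; rewrite sqr_ge0.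
Qed.

Lemma kerC G (u v : G) : adj_val u v = adj_val v u.
Proof. by rewrite /adj_val adj_sym. Qed.

Lemma ker_ge0 G (u v : G) : 0 <= adj_val u v.
Proof. by rewrite /adj_val. Qed.

Lemma deg_ge0 G (v : G) : 0 <= degree v.
Proof. by apply: sumr_ge0 => u _; exact: ker_ge0. Qed.

(** In the quadratic form at a unit eigenvector, replace each product of entries by the mean of
    their squares. *)
Lemma eigen_le_deg G d x D : spectral (@adj_val G) d x ->
  (forall v : G, degree v <= D) -> forall i, d i <= D.
Proof.
move=> sG degD i; rewrite -(quad_eigen i sG) /quad.
have [o1 _ _] := sG.
apply: le_trans (_ : \sum_u degree u * x i u ^+ 2 <= _); last first.
  apply: le_trans (_ : \sum_u D * x i u ^+ 2 <= _).
    by apply: ler_sum => u _; rewrite ler_wpM2r ?sqr_ge0.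
  by rewrite -mulr_sumr (o1 i i) eqxx mulr1.
have e : \sum_u degree u * x i u ^+ 2 =
    \sum_u \sum_v adj_val u v * ((x i u ^+ 2 + x i v ^+ 2) / 2).
  apply/eqP; rewrite -subr_eq0; apply/eqP.
  have -> : \sum_u \sum_v adj_val u v * ((x i u ^+ 2 + x i v ^+ 2) / 2) =
    \sum_u degree u * x i u ^+ 2 / 2 + \sum_u degree u * x i u ^+ 2 / 2.
    have sw : \sum_(u : G) \sum_(v : G) adj_val u v * (x i u ^+ 2 / 2) =
        \sum_u degree u * x i u ^+ 2 / 2.
      by apply: eq_bigr => u _; rewrite -mulr_suml mulrA.
    rewrite -{1}sw -sw [X in _ = _ + X]exchange_big /= -big_split /=.
    apply: eq_bigr => u _; rewrite -big_split /=; apply: eq_bigr => v _.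
    by rewrite (kerC v u); field.
  by rewrite -!mulr_suml; field.
rewrite e; apply: ler_sum => u _; apply: ler_sum => v _.
apply: ler_wpM2l; first exact: ker_ge0.
by have := sqr_ge0 (x i u - x i v); rewrite sqrrB; lra.
Qed.

(** The second moment at [v] is the degree. Unless it is at most [2 p], one has
    [deg - p >= deg / 2], whence the factor [16 = 2^4] in [local_moment]. *)
Lemma deg_local G d x v lam : spectral (@adj_val G) d x ->
  (forall i, d i <= lam) ->
  degree v <= 2 * local_pos d x v \/
  degree v ^+ 4 <= 16 * lam ^+ 2 * local_pos d x v ^+ 3.
Proof.
move=> sG dl.
have avv : adj_val v v = 0 by rewrite /adj_val adj_irrefl.
have := local_moment sG (@ker_ge0 G) avv dl.
have -> : \sum_u adj_val v u * adj_val u v = degree v.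
  apply: eq_bigr => u _; rewrite (kerC u) /adj_val; case: adj; rewrite ?mulr1 ?mulr0 //.
set p := local_pos _ _ _ => h; have p0 : 0 <= p := local_pos_ge0 d x v.
case: (leP (degree v) (2 * p)) => [|lt]; [by left|right].
have : (degree v / 2) ^+ 4 <= (degree v - p) ^+ 4.
  by rewrite lerXn2r ?nnegrE; lra.
rewrite expr_div_n => h2; have := le_trans h2 h; lra.
Qed.

End Graphs.

(** * Lower bound for the positive square energy *)

Section SquareEnergy.
Variable R : realType.
Implicit Type G : sgraph.
Local Notation ker := (@adj_val R _).
Local Notation deg := (@degree R _).
Local Notation degr P := (@degree R (restrict P)).

Lemma sum_deg G : \sum_(v : G) deg v = 2 * (num_edges G)%:R.
Proof.
have cnt : (\sum_(p : G * G | adj p.1 p.2) 1 = 2 * num_edges G)%N.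
  pose h (p : G * G) := [set p.1; p.2].
  rewrite (partition_big h (mem (edges G))) /=; last first.
    by move=> p ap; apply/imsetP; exists p; rewrite ?inE.
  (* The fibre over an edge consists of its two orientations. *)
  rewrite (eq_bigr (fun=> 2)) ?sum_nat_const 1?mulnC // => e /imsetP[[u v]].
  rewrite inE /= => auv ->.
  have uv : u != v by apply: contraTneq auv => ->; rewrite adj_irrefl.
  have uvvu : (u, v) != (v, u) by rewrite xpair_eqE negb_and uv.
  rewrite sum1_card -[RHS](_ : #|[set (u, v); (v, u)]| = 2); last by rewrite cards2 uvvu.
  apply: eq_card => -[a b]; rewrite !inE /= unfold_in /= !xpair_eqE.
  apply/andP/orP => [[aab /eqP hE]|[] /andP[/eqP-> /eqP->]]; last 2 first.
  - by rewrite auv eqxx.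
  - by rewrite adj_sym auv /h /= setUC eqxx.
  have ab : a != b by apply: contraTneq aab => ->; rewrite adj_irrefl.
  have : a \in [set u; v] by rewrite -hE set21.
  have : b \in [set u; v] by rewrite -hE set22.
  rewrite !inE => /orP[]/eqP bE /orP[]/eqP aE; move: ab; rewrite bE aE ?eqxx //.
    by right.
  by left.
rewrite -natrM -cnt natr_sum /= /degree pair_bigA /= [RHS]big_mkcond /=.
by apply: eq_bigr => p _; rewrite /adj_val; case: adj.
Qed.

Lemma deg_restrict_le G (P : pred G) (v : G) : degr P v <= deg v.
Proof.
apply: ler_sum => u _; rewrite /adj_val /= ler_nat.
by case: (P v) => //=; case: (P u).
Qed.

(** An ordered adjacent pair inside [Q] but not inside [P] has its first or its second endpoint
    outside [P], whence the factor 2. *)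
Lemma sum_deg_restrict G (P Q : pred G) : subpred P Q ->
  \sum_(v : G) degr Q v <=
  \sum_(v : G) degr P v + 2 * \sum_(v | Q v && ~~ P v) degr Q v.
Proof.
move=> PQ; pose k u v : R := @adj_val R (restrict Q) u v.
have kC u v : k u v = k v u by apply: kerC.
have -> : 2 * \sum_(v | Q v && ~~ P v) degr Q v =
    \sum_(u : G) \sum_(v : G) ((~~ P u)%:R * k u v + (~~ P v)%:R * k u v).
  transitivity (\sum_(u : G) \sum_(v : G) (~~ P u)%:R * k u v
              + \sum_(u : G) \sum_(v : G) (~~ P v)%:R * k u v); last first.
    by rewrite -big_split; apply: eq_bigr => u _; rewrite -big_split.
  rewrite [X in _ = _ + X]exchange_big /=.
  have -> : \sum_(v : G) \sum_(u : G) (~~ P v)%:R * k u v =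
            \sum_(u : G) \sum_(v : G) (~~ P u)%:R * k u v.
    by apply: eq_bigr => u _; apply: eq_bigr => v _; rewrite kC.
  rewrite mulr_natl mulr2n; suff -> : \sum_(v | Q v && ~~ P v) degr Q v =
    \sum_(u : G) \sum_(v : G) (~~ P u)%:R * k u v by [].
  rewrite big_mkcond; apply: eq_bigr => u _; rewrite -mulr_sumr.
  case: (P u) => /=; rewrite ?andbF ?mul0r // andbT mul1r.
  case: ifP => // Qu; rewrite big1 // => v _; rewrite /k /adj_val /= Qu //.
rewrite -big_split; apply: ler_sum => u _; rewrite -big_split; apply: ler_sum => v _ /=.
rewrite /k /adj_val /= -!natrM -!natrD ler_nat.
case: (boolP (P u)) => [/PQ ->|_]; last first.
  by case: (P v); case: (Q u); case: (Q v); case: (adj u v).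
case: (boolP (P v)) => [/PQ ->|_]; by case: (Q v); case: (adj u v).
Qed.

(** Since [1 <= D], the alternative [deg <= 2 p] of [deg_local] also gives the quartic bound:
    [deg^4 <= D (2 p)^3 <= 16 D^2 p^3]. *)
Lemma local_mass G D : 1 <= D -> (forall v : G, deg v <= D) ->
  exists p : G -> R, [/\ forall v, 0 <= p v, \sum_v p v = splus R G &
    forall v, deg v ^+ 4 <= 16 * D ^+ 2 * p v ^+ 3].
Proof.
move=> D1 degD; have [d [x [sG -> _]]] := graph_spectral R G.
exists (local_pos d x); split; rewrite ?(sum_local_pos sG) //.
  by move=> v; exact: local_pos_ge0.
move=> v; have p0 := local_pos_ge0 d x v.
case: (deg_local v sG (eigen_le_deg sG degD)) => // le2.
have le8 : deg v ^+ 3 <= 8 * local_pos d x v ^+ 3.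
  rewrite [leRHS](_ : _ = (2 * local_pos d x v) ^+ 3); last by ring.
  by rewrite lerXn2r ?nnegrE ?deg_ge0 // mulr_ge0.
apply: le_trans (_ : D * (8 * local_pos d x v ^+ 3) <= _).
  by rewrite exprS; apply: ler_pM; rewrite ?deg_ge0 ?exprn_ge0 ?deg_ge0.
rewrite mulrA ler_wpM2r ?exprn_ge0 //; nra.
Qed.

(** Here [lam] is the square root of the energy, and the alternative [deg <= 2 p] is absorbed by
    [p <= splus R G]. *)
Lemma local_mass_splus G :
  exists p : G -> R, [/\ forall v, 0 <= p v, \sum_v p v = splus R G &
    forall v, deg v ^+ 4 <= 16 * splus R G * p v ^+ 3].
Proof.
have [d [x [sG -> _]]] := graph_spectral R G.
have S0 : 0 <= pos_sqr d by apply: sumr_ge0 => i _; rewrite sqr_ge0.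
exists (local_pos d x); split; rewrite ?(sum_local_pos sG) //.
  by move=> v; exact: local_pos_ge0.
move=> v; have p0 := local_pos_ge0 d x v.
have dS i : d i <= Num.sqrt (pos_sqr d).
  have [di|di] := leP (d i) 0; first by rewrite (le_trans di) ?sqrtr_ge0.
  apply: le_trans (ler_norm _) _; rewrite -sqrtr_sqr; apply: ler_wsqrtr.
  by rewrite /pos_sqr (bigD1 i (ltW di)) /= lerDl sumr_ge0 // => j _; rewrite sqr_ge0.
case: (deg_local v sG dS); last by rewrite sqr_sqrtr.
move=> le2.
have pS : local_pos d x v <= pos_sqr d.
  rewrite -(sum_local_pos sG) (bigD1 v) //= lerDl.
  by apply: sumr_ge0 => u _; exact: local_pos_ge0.
have le8 : deg v ^+ 3 <= 8 * local_pos d x v ^+ 3.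
  rewrite [leRHS](_ : _ = (2 * local_pos d x v) ^+ 3); last by ring.
  by rewrite lerXn2r ?nnegrE ?deg_ge0 // mulr_ge0.
rewrite (_ : 16 * _ * _ = (2 * pos_sqr d) * (8 * local_pos d x v ^+ 3)); last by ring.
rewrite exprS; apply: ler_pM; rewrite ?deg_ge0 ?exprn_ge0 ?deg_ge0 //.
by apply: le_trans le2 _; rewrite ler_pM2l.
Qed.

(* Weighted arithmetic-geometric mean inequality for [2 r^2 p^(3/4)]. *)
Lemma young (D p r z : R) : 0 <= D -> 0 <= p -> 0 < r -> 0 < z ->
  D ^+ 4 <= 16 * r ^+ 8 * p ^+ 3 -> D <= 2 * r * z * p + r ^+ 5 / z ^+ 3.
Proof.
move=> D0 p0 r0 z0 h; rewrite leNgt; apply/negP => lt.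
pose X := 2 * r * z * p; pose Y := r ^+ 5 / z ^+ 3.
have X0 : 0 <= X by rewrite !mulr_ge0 // ltW.
have Y0 : 0 <= Y by rewrite divr_ge0 // exprn_ge0 // ltW.
have l1 : (X + Y) ^+ 4 < D ^+ 4 by rewrite ltrXn2r ?nnegrE // addr_ge0.
(* This single binomial term equals [32 r^8 p^3], too much for the bound [16 r^8 p^3]. *)
have l2 : 4 * (X ^+ 3 * Y) <= (X + Y) ^+ 4.
  have h4 := exprn_ge0 4 X0; have h1 := exprn_ge0 4 Y0.
  have h2 : 0 <= X ^+ 2 * Y ^+ 2 by rewrite mulr_ge0 ?sqr_ge0.
  have h3 : 0 <= X * Y ^+ 3 by rewrite mulr_ge0 // exprn_ge0.
  rewrite (_ : (X + Y) ^+ 4 = X ^+ 4 + 4 * (X ^+ 3 * Y) + 6 * (X ^+ 2 * Y ^+ 2) +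
    4 * (X * Y ^+ 3) + Y ^+ 4); last by ring.
  lra.
have e : X ^+ 3 * Y = 8 * (r ^+ 8 * p ^+ 3) by rewrite /X /Y; field; exact: lt0r_neq0.
have := lt_le_trans (le_lt_trans l2 l1) h; rewrite e.
have : 0 <= r ^+ 8 * p ^+ 3 by rewrite mulr_ge0 // exprn_ge0 // ltW.
lra.
Qed.

Lemma ex_pow2 (x : R) : 1 <= x -> exists J : nat, x <= 2 ^+ J <= 2 * x.
Proof.
move=> x1; have ex : exists J, x <= 2 ^+ J.
  exists (Num.bound x); apply: le_trans (ltW (archi_boundP _)) _.
    exact: le_trans x1.
  by rewrite -natrX ler_nat ltnW // ltn_expl.
exists (ex_minn ex); case: ex_minnP => -[|J] hJ minJ; rewrite hJ /=.
  by rewrite expr0; lra.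
rewrite exprS ler_pM2l // leNgt; apply/negP => /ltW /minJ.
by rewrite ltnn.
Qed.

(** With [y = m^(1/28)] every exponent is an integer: the energy is compared with [y^24], and the
    degree cutoff is about [y^12]. If the bound failed, the degree sum [2 y^28] would be too
    small. *)
Lemma splus_ge_pow G (y : R) : 1 <= y -> (num_edges G)%:R = y ^+ 28 ->
  y ^+ 24 / 100 <= splus R G.
Proof.
move=> y1 mE; rewrite leNgt; apply/negP => Slt.
have y0 : 0 < y by exact: lt_le_trans y1.
have sumd : \sum_(v : G) deg v = 2 * y ^+ 28 by rewrite sum_deg mE.
pose low j (v : G) := deg v < 16 ^+ j.
have step j : \sum_(v | low j.+1 v && ~~ low j v) degr (low j.+1) v
    <= 2225 / 10000 * 2 ^+ j.+1 * y ^+ 25.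
  set r : R := 2 ^+ j.+1; have r0 : 0 < r by rewrite exprn_gt0.
  have tE : 16 ^+ j.+1 = r ^+ 4 :> R.
    by rewrite -exprM mulnC exprM; congr (_ ^+ _); ring.
  have tE' : 16 * 16 ^+ j = r ^+ 4 :> R by rewrite -exprS.
  have [|v|p [p0 pS pd]] := @local_mass (restrict (low j.+1)) (r ^+ 4).
  - by rewrite -tE exprn_ege1 // ler1n.
  - rewrite -tE; have [lv|nlv] := boolP (low j.+1 v).
      by apply: le_trans (deg_restrict_le _ _) _; exact: ltW lv.
    rewrite /degree big1 ?exprn_ge0 // => u _.
    by rewrite /adj_val /= (negPf nlv).
  set U := fun v : G => low j.+1 v && ~~ low j v.
  (* Both terms of [young] become multiples of [r y^25]: the mass term gives [16/100] and the
     counting term [32/512], in total [2225/10000]. *)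
  pose z := 8 * y; have z0 : 0 < z by rewrite mulr_gt0.
  apply: le_trans (_ : \sum_(v | U v) (2 * r * z * p v + r ^+ 5 / z ^+ 3) <= _).
    apply: ler_sum => v _; apply: young => //; first exact: deg_ge0.
    by have := pd v; rewrite -exprM.
  (* Each vertex of [U] has degree at least [r^4 / 16]. *)
  have cU : \sum_(v : G | U v) r ^+ 4 <= 32 * y ^+ 28.
    apply: le_trans (_ : \sum_(v : G | U v) 16 * deg v <= _).
      apply: ler_sum => v /andP[_]; rewrite /low -leNgt => ld.
      by rewrite -tE' ler_pM2l.
    rewrite -mulr_sumr; apply: le_trans (_ : 16 * (\sum_(v : G) deg v) <= _).
      rewrite ler_pM2l // [leRHS](bigID U) /= lerDl.
      by apply: sumr_ge0 => v _; exact: deg_ge0.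
    by rewrite sumd; lra.
  rewrite big_split /= -mulr_sumr.
  have -> : \sum_(v : G | U v) r ^+ 5 / z ^+ 3 = (\sum_(v | U v) r ^+ 4) * (r / z ^+ 3).
    by rewrite mulr_suml; apply: eq_bigr => v _; rewrite exprSr mulrA.
  have h1 : \sum_(v | U v) p v <= y ^+ 24 / 100.
    apply: le_trans (ltW Slt); apply: le_trans (splus_restrict R (low j.+1)).
    rewrite -pS [leRHS](bigID U) /= lerDl.
    by apply: sumr_ge0 => v _; exact: p0.
  have h2 : 2 * r * z * \sum_(v | U v) p v <= 2 * r * z * (y ^+ 24 / 100).
    by rewrite ler_wpM2l // !mulr_ge0 // ltW.
  have h3 : (\sum_(v : G | U v) r ^+ 4) * (r / z ^+ 3) <= 32 * y ^+ 28 * (r / z ^+ 3).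
    by rewrite ler_wpM2r // divr_ge0 ?exprn_ge0 // ltW.
  apply: le_trans (lerD h2 h3) _; rewrite le_eqVlt; apply/orP; left; apply/eqP.
  by rewrite /z; field; exact: lt0r_neq0.
(* The constant solves [c + 4 * 2225/10000 = 2 c]. At [j = 0] the vertices of degree below 1 are
   isolated. *)
have acc j : \sum_(v : G) degr (low j) v <= 89 / 100 * 2 ^+ j * y ^+ 25.
  elim: j => [|j IHj].
    rewrite big1; first by rewrite expr0 mulr1 mulr_ge0 ?divr_ge0 ?exprn_ge0 ?(ltW y0).
    move=> v _.
    rewrite /degree big1 // => u _; rewrite /adj_val /= /low expr0.
    case: (boolP (adj v u)) => [avu|]; last by rewrite !andbF.
    suff /negPf-> : ~~ (deg v < 1) by [].
    rewrite -leNgt /degree (bigD1 u) //= {1}/adj_val avu lerDl.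
    by apply: sumr_ge0 => w _; exact: ker_ge0.
  apply: le_trans (sum_deg_restrict (_ : subpred (low j) _)) _.
    by move=> v; rewrite /low => /lt_le_trans; apply; rewrite ler_eXn2l ?ltr1n.
  apply: le_trans (lerD IHj (_ : _ <= 2 * (2225 / 10000 * 2 ^+ j.+1 * y ^+ 25))) _.
    by rewrite ler_pM2l.
  by rewrite (exprS 2 j) le_eqVlt; apply/orP; left; apply/eqP; field.
(* The lower bound on [2^J] puts the cutoff [16^J] above [y^12]; the upper bound keeps the low part
   below [178/100 y^28]. *)
have [|J /andP[J1 J2]] := @ex_pow2 (y ^+ 3); first by rewrite exprn_ege1.
have T12 : y ^+ 12 <= 16 ^+ J.
  have -> : 16 ^+ J = (2 ^+ J) ^+ 4 :> R.
    by rewrite -exprM mulnC exprM; congr (_ ^+ _); ring.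
  by rewrite (exprM y 3 4) lerXn2r ?nnegrE ?exprn_ge0 // ltW.
have [p [p0 pS pd]] := local_mass_splus G.
(* Otherwise [deg^4 >= y^12 deg^3] would exceed [y^24 p^3], whereas it is at most [16 splus p^3],
   with [splus] below [y^24 / 100]. *)
have high v : ~~ low J v -> deg v <= y ^+ 4 * p v.
  rewrite /low -leNgt => /(le_trans T12) dv; rewrite leNgt; apply/negP => lt.
  have h1 : (y ^+ 4 * p v) ^+ 3 < deg v ^+ 3.
    by rewrite ltrXn2r ?nnegrE ?deg_ge0 ?mulr_ge0 ?exprn_ge0 // ltW.
  have h2 : y ^+ 12 * (y ^+ 4 * p v) ^+ 3 < deg v ^+ 4.
    rewrite [ltRHS]exprS; apply: lt_le_trans (_ : y ^+ 12 * deg v ^+ 3 <= _).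
      by rewrite ltr_pM2l // exprn_gt0.
    by rewrite ler_wpM2r // exprn_ge0 // deg_ge0.
  have h3 := lt_le_trans h2 (pd v).
  have p3 : 0 <= p v ^+ 3 by rewrite exprn_ge0.
  have h4 : 16 * splus R G * p v ^+ 3 <= y ^+ 24 * p v ^+ 3.
    by rewrite ler_wpM2r //; have := exprn_ge0 24 (ltW y0); lra.
  have := lt_le_trans h3 h4; rewrite (_ : _ * (_ * _) ^+ 3 = y ^+ 24 * p v ^+ 3) ?ltxx //.
  by ring.
(* Low part and twice the high part total at most [180/100 y^28], less than [2 y^28]. *)
have := @sum_deg_restrict G (low J) predT (fun _ _ => isT).
have -> : \sum_(v : G) degr predT v = 2 * y ^+ 28 by rewrite -sumd.
have hi : \sum_(v : G | predT v && ~~ low J v) degr predT v <= y ^+ 28 / 100.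
  apply: le_trans (_ : \sum_(v : G | predT v && ~~ low J v) y ^+ 4 * p v <= _).
    by apply: ler_sum => v /andP[_ nl]; exact: le_trans (deg_restrict_le _ _) (high _ nl).
  rewrite -mulr_sumr; apply: le_trans (_ : y ^+ 4 * (y ^+ 24 / 100) <= _).
    rewrite ler_pM2l ?exprn_gt0 //; apply: le_trans (ltW Slt); rewrite -pS.
    rewrite [leRHS](bigID (fun v : G => predT v && ~~ low J v)) /= lerDl.
    by apply: sumr_ge0 => v _; exact: p0.
  by rewrite le_eqVlt; apply/orP; left; apply/eqP; field.
have lo : \sum_(v : G) degr (low J) v <= 178 / 100 * y ^+ 28.
  apply: le_trans (acc J) _.
  rewrite (_ : 178 / 100 * y ^+ 28 = 89 / 100 * (2 * y ^+ 3) * y ^+ 25); last by field.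
  by rewrite ler_wpM2r ?exprn_ge0 ?(ltW y0) // ler_wpM2l ?divr_ge0.
have y28 : 0 < y ^+ 28 by rewrite exprn_gt0.
move: lo hi y28; lra.
Qed.

End SquareEnergy.
(** * Lower bound for the negative square energy *)

Section Gram.
Variables (R : realType) (T I : finType) (w : I -> R) (Y : I -> T -> R).

Definition gram (u v : T) : R := \sum_c w c * (Y c u * Y c v).

Lemma quad_gram y : quad gram y = \sum_c w c * (\sum_u Y c u * y u) ^+ 2.
Proof.
rewrite /quad /gram; under eq_bigr do under eq_bigr do rewrite mulr_suml.
under eq_bigr do rewrite exchange_big.
rewrite exchange_big /=; apply: eq_bigr => c _; rewrite expr2 big_distrlr /= mulr_sumr.
by apply: eq_bigr => u _; rewrite mulr_sumr; apply: eq_bigr => v _; ring.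
Qed.

Lemma gram_psd : (forall c, 0 <= w c) -> psd gram.
Proof.
by move=> w0 y; rewrite quad_gram; apply: sumr_ge0 => c _; rewrite mulr_ge0 ?sqr_ge0.
Qed.

Lemma inner_gram a : inner a gram = \sum_c w c * quad a (Y c).
Proof.
rewrite /inner /gram; under eq_bigr do under eq_bigr do rewrite mulr_sumr.
under eq_bigr do rewrite exchange_big.
rewrite exchange_big /=; apply: eq_bigr => c _; rewrite mulr_sumr.
by apply: eq_bigr => u _; rewrite mulr_sumr; apply: eq_bigr => v _; ring.
Qed.

Lemma frob_gram : frob gram =
  \sum_c \sum_c' w c * w c' * (\sum_u Y c u * Y c' u) ^+ 2.
Proof.
transitivity (inner gram gram).
  by apply: eq_bigr => u _; apply: eq_bigr => v _; rewrite expr2.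
rewrite inner_gram; apply: eq_bigr => c _; rewrite quad_gram mulr_sumr.
apply: eq_bigr => c' _; rewrite mulrA; congr (_ * _ ^+ 2).
by apply: eq_bigr => u _; rewrite mulrC.
Qed.

End Gram.

(** * Maximal matchings *)

Section Matching.
Variable G : sgraph.

(* A matching is encoded by the involution exchanging the endpoints of its edges. *)
Definition matching (f : {ffun G -> G}) :=
  [forall u, (f (f u) == u) && ((f u == u) || adj u (f u))].

Lemma matchingP (f : {ffun G -> G}) : reflect
  (forall u, f (f u) = u /\ (f u != u -> adj u (f u))) (matching f).
Proof.
apply: (iffP forallP) => h u; have := h u.
  by case/andP => /eqP-> /orP[->|->].
by case=> -> h2; rewrite eqxx /=; case: eqP h2 => //= _ ->.
Qed.

(** Take a matching moving the most vertices; exchanging two adjacent fixed points would move two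
    more. *)
Lemma ex_maximal_matching : exists2 f : {ffun G -> G}, matching f &
  forall u v, f u = u -> f v = v -> ~~ adj u v.
Proof.
pose id0 := [ffun u : G => u].
have m0 : matching id0 by apply/matchingP => u; rewrite !ffunE eqxx.
case: (@arg_maxnP _ id0 matching (fun f => #|[set u | f u != u]|) m0) => f mf maxf.
exists f => // u v fu fv; apply/negP => auv.
have uv : u != v by apply: contraTneq auv => ->; rewrite adj_irrefl.
have /matchingP fP := mf.
pose f' := [ffun x => if x == u then v else if x == v then u else f x].
have f'u : f' u = v by rewrite ffunE eqxx.
have f'v : f' v = u by rewrite ffunE eq_sym (negPf uv) eqxx.
have f'x x : x != u -> x != v -> f' x = f x.
  by rewrite ffunE => /negPf-> /negPf->.
have mf' : matching f'.
  apply/matchingP => x; have [->|xu] := eqVneq x u; first by rewrite f'u f'v.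
  have [->|xv] := eqVneq x v; first by rewrite f'v f'u adj_sym.
  have [ffx ax] := fP x; rewrite (f'x x) // f'x //.
    by apply: contra_neq xu => fxu; rewrite -ffx fxu fu.
  by apply: contra_neq xv => fxv; rewrite -ffx fxv fv.
have max' : (#|[set x | f' x != x]| <= #|[set x | f x != x]|)%N := maxf f' mf'.
move: max'; rewrite leqNgt => /negP; apply; apply: proper_card.
apply/properP; split.
  apply/subsetP => x; rewrite !inE => fx.
  have xu : x != u by apply: contra_neq fx => ->.
  have xv : x != v by apply: contra_neq fx => ->.
  by rewrite f'x.
by exists u; rewrite !inE ?fu ?eqxx // f'u eq_sym.
Qed.

End Matching.

(** * Test matrices from matchings and stars *)

Section NegativeSquareEnergy.
Variables (R : realType) (G : sgraph).
Local Notation ker := (@adj_val R G).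

(** Testing [-A] against the Gram kernel gives [(2 k)^2 <= 4 C k s], with [s] the negative energy;
    divide by [4 k]. *)
Lemma sminus_test (I : finType) (w : I -> R) (Y : I -> G -> R) (k C : R) :
  0 < C -> 0 <= k -> (forall c, 0 <= w c) ->
  \sum_c w c * quad ker (Y c) = - (2 * k) ->
  \sum_c \sum_c' w c * w c' * (\sum_u Y c u * Y c' u) ^+ 2 = 4 * C * k ->
  k <= C * sminus R G.
Proof.
move=> C0 k0 w0 iE fE; have [d [x [sG _ ->]]] := graph_spectral R G.
have sN := spectralN sG.
have i2 : inner (fun u v : G => - (adj u v)%:R) (gram w Y) = 2 * k.
  rewrite -[RHS]opprK -iE -(inner_gram w Y ker) /inner -sumrN.
  by apply: eq_bigr => u _; rewrite -sumrN; apply: eq_bigr => v _; rewrite mulNr.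
have := inner_psd_le sN (gram_psd Y w0); rewrite i2 frob_gram fE mulr_ge0 // => /(_ isT) h.
have S0 : 0 <= pos_sqr (fun i => - d i) by apply: sumr_ge0 => i _; rewrite sqr_ge0.
have [->|n0] := eqVneq k 0; first by rewrite mulr_ge0 // ltW.
have kgt : 0 < k by rewrite lt_neqAle eq_sym n0.
rewrite -(ler_pM2r (_ : 0 < 4 * k)); last by rewrite mulr_gt0.
by apply: le_trans (_ : (2 * k) ^+ 2 <= _); [lra|apply: le_trans h _; lra].
Qed.

Lemma quadB_delta (c e : G) : quad ker (fun u => (c == u)%:R - (e == u)%:R) =
  - (2 * ker c e).
Proof.
rewrite /quad.
transitivity (\sum_u ((c == u)%:R - (e == u)%:R) * (ker u c - ker u e)).
  apply: eq_bigr => u _.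
  rewrite -(sum_delta (fun v => ker u v) c) -(sum_delta (fun v => ker u v) e).
  by rewrite -sumrB mulr_sumr; apply: eq_bigr => v _ /=; ring.
transitivity (\sum_u (c == u)%:R * (ker u c - ker u e)
            - \sum_u (e == u)%:R * (ker u c - ker u e)).
  by rewrite -sumrB; apply: eq_bigr => u _; ring.
rewrite (sum_delta (fun u => ker u c - ker u e)) (sum_delta (fun u => ker u c - ker u e)).
by rewrite (kerC _ e c) /adj_val !adj_irrefl /=; ring.
Qed.

(** The test vectors are differences of the basis vectors at [c] and [f c]. They vanish at unmatched
    [c], and each matched edge occurs twice, which gives the factor 2. *)
Lemma sminus_matching (f : {ffun G -> G}) : matching f ->
  #|[set u | f u != u]|%:R <= 2 * sminus R G.
Proof.
move/matchingP => fP.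
have ff u : f (f u) = u by have [] := fP u.
have kE : #|[set u | f u != u]|%:R = \sum_u (1 - (f u == u)%:R) :> R.
  rewrite -sum1_card natr_sum big_mkcond; apply: eq_bigr => u _.
  by rewrite inE; case: eqP => _ /=; ring.
apply: (@sminus_test G (fun _ => 1) (fun c u => (c == u)%:R - (f c == u)%:R)) => //.
  rewrite kE mulr_sumr -sumrN; apply: eq_bigr => c _.
  rewrite mul1r quadB_delta /adj_val; have [_] := fP c.
  by have [-> _|_ ->] := eqVneq (f c) c; rewrite ?adj_irrefl //=; ring.
rewrite kE mulr_sumr; apply: eq_bigr => c _.
(* The squared inner product is 4 at [c' = c] and at [c' = f c]; the term with 8 cancels both when
   [c] is fixed. *)
transitivity (\sum_c' ((c == c')%:R * (4 - 8 * (f c == c')%:R) + (f c == c')%:R * 4) : R).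
  apply: eq_bigr => c' _.
  have -> : \sum_u ((c == u)%:R - (f c == u)%:R) * ((c' == u)%:R - (f c' == u)%:R) =
      2 * ((c == c')%:R - (f c == c')%:R) :> R.
    transitivity (\sum_u (c == u)%:R * ((c' == u)%:R - (f c' == u)%:R)
                - \sum_u (f c == u)%:R * ((c' == u)%:R - (f c' == u)%:R) : R).
      by rewrite -sumrB; apply: eq_bigr => u _; ring.
    rewrite !(sum_delta (fun u => (c' == u)%:R - (f c' == u)%:R)).
    by rewrite (can_eq ff) (can2_eq ff ff) ![c' == _]eq_sym; ring.
  by case: (c == c'); case: (f c == c') => /=; ring.
rewrite big_split /= (sum_delta (fun c' => 4 - 8 * (f c == c')%:R)).
by rewrite (sum_delta (fun=> 4)); ring.
Qed.

(** [L] splits into stars with centres [g u]. For a star with [t] leaves, the test vector is the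
    eigenvector of its eigenvalue [- sqrt t]: [sqrt t] at the centre and [-1] at the leaves.
    Distinct stars give orthogonal vectors, since by independence no centre lies in [L]. *)
Lemma sminus_stars (L : {set G}) (g : G -> G) :
  {in L &, forall u v, ~~ adj u v} -> {in L, forall u, adj u (g u)} ->
  #|L|%:R <= sminus R G.
Proof.
move=> indL adjg.
pose l c u : R := ((u \in L) && (g u == c))%:R.
pose t c := \sum_u l c u; pose s c := Num.sqrt (t c).
have t0 c : 0 <= t c by apply: sumr_ge0.
have s2 c : s c ^+ 2 = t c by rewrite sqr_sqrtr.
have tL : \sum_c t c = #|L|%:R.
  rewrite exchange_big /= -sum1_card natr_sum [RHS]big_mkcond; apply: eq_bigr => u _.
  case: (boolP (u \in L)) => uL; last by rewrite big1 // => c _; rewrite /l (negPf uL).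
  rewrite -[RHS](sum_delta (fun=> 1) (g u)); apply: eq_bigr => c _.
  by rewrite /l uL mulr1.
have tcL c : c \in L -> t c = 0.
  move=> cL; apply: big1 => u _; rewrite /l; case: andP => //= -[uL /eqP gu].
  by have := indL u c uL cL; rewrite -gu adjg.
pose Y c u := s c * (c == u)%:R - l c u.
have ll c u : l c u * l c u = l c u by rewrite /l; case: andP; rewrite ?mulr1 ?mulr0.
have sl c c' : s c * l c' c = 0.
  rewrite /l; case: (boolP (c \in L)) => cL /=; rewrite ?mulr0 //.
  by rewrite /s tcL // sqrtr0 mul0r.
have qY c : quad ker (Y c) = - (2 * (s c * t c)).
  have e1 u v : ker u v * (l c u * l c v) = 0.
    rewrite /l /adj_val; case: (boolP (u \in L)) => uL /=; rewrite ?(mul0r, mulr0) //.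
    case: (boolP (v \in L)) => vL /=; rewrite ?(mul0r, mulr0) //.
    by rewrite (negPf (indL u v uL vL)) mul0r.
  have e2 : \sum_u ker c u * l c u = t c.
    apply: eq_bigr => u _; rewrite /l /adj_val.
    case: (boolP (u \in L)) => uL /=; rewrite ?mulr0 //.
    by case: eqP => [<-|]; rewrite ?mulr0 // adj_sym adjg ?mulr1.
  transitivity (\sum_u (c == u)%:R * (s c ^+ 2 * \sum_v (c == v)%:R * ker u v)
     - \sum_u (c == u)%:R * (s c * \sum_v ker u v * l c v)
     - \sum_u l c u * (s c * \sum_v (c == v)%:R * ker u v)).
    rewrite -!sumrB; apply: eq_bigr => u _; rewrite !mulr_sumr -!sumrB.
    by apply: eq_bigr => v _; have := e1 u v; rewrite /Y => h; ring: h.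
  rewrite !(sum_delta (fun u => _)) /= e2.
  under [X in _ - X]eq_bigr do rewrite sum_delta mulrCA [_ * ker _ _]mulrC kerC.
  by rewrite -mulr_sumr e2 /adj_val adj_irrefl /=; ring.
have YY c c' : \sum_u Y c u * Y c' u = (c == c')%:R * (2 * t c).
  transitivity (\sum_u (c == u)%:R * (s c * s c' * (c' == u)%:R - s c * l c' u)
    - \sum_u (c' == u)%:R * (s c' * l c u) + \sum_u l c u * l c' u).
    by rewrite -sumrB -big_split; apply: eq_bigr => u _; rewrite /Y /=; ring.
  rewrite (sum_delta (fun u => s c * s c' * (c' == u)%:R - s c * l c' u)).
  rewrite (sum_delta (fun u => s c' * l c u)) !sl [c' == c]eq_sym.
  case: eqP => [<-|/eqP cc'] /=.
    by under eq_bigr do rewrite ll; rewrite -/(t c) -expr2 s2; ring.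
  rewrite big1; first by ring.
  move=> u _; rewrite /l; case: (u \in L); rewrite ?mul0r //=.
  by case: eqP => [->|]; rewrite ?mul0r // (negPf cc') mulr0.
(* For [c] without leaves the weight is the default inverse of 0, and both sides vanish. *)
have sV c : (s c)^-1 * (s c * t c) = t c.
  have [s0|sn] := eqVneq (s c) 0; last by rewrite mulKf.
  by rewrite s0 mul0r mulr0 -s2 s0 expr0n.
have sVV c : (s c)^-1 * ((s c)^-1 * (t c * t c)) = t c.
  have [s0|sn] := eqVneq (s c) 0; last by rewrite -!s2; field.
  by rewrite s0 invr0 mul0r -s2 s0 expr0n.
rewrite -[leRHS]mul1r.
apply: (@sminus_test G (fun c => (s c)^-1) Y) => // [c||].
- by rewrite invr_ge0 sqrtr_ge0.
- rewrite -tL mulr_sumr -sumrN; apply: eq_bigr => c _.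
  by rewrite qY mulrN mulrCA sV.
rewrite -tL mulr_sumr; apply: eq_bigr => c _.
transitivity (\sum_c' (c == c')%:R * ((s c)^-1 * (s c')^-1 * (2 * t c) ^+ 2)).
  by apply: eq_bigr => c' _; rewrite YY; case: eqP => _ /=; ring.
rewrite sum_delta (_ : _ * _ = 4 * ((s c)^-1 * ((s c)^-1 * (t c * t c)))); last by ring.
by rewrite sVV mulr1.
Qed.

(** Of the non-isolated vertices, at most [2 s] are matched and, by maximality and the star bound,
    at most [s] are not, where [s] is the negative energy. *)
Lemma num_edges_le_sminus : (num_edges G)%:R <= (3 * sminus R G) ^+ 2.
Proof.
pose N := [set u : G | [exists v, adj u v]].
have le1 : 2 * (num_edges G)%:R <= #|N|%:R ^+ 2 :> R.
  rewrite -sum_deg -sum1_card natr_sum expr2 big_distrlr /= [leRHS]big_mkcond /=.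
  apply: ler_sum => u _; case: ifPn => uN.
    rewrite [leRHS]big_mkcond; apply: ler_sum => v _; rewrite mulr1 /adj_val.
    rewrite inE; case: existsP; first by case: adj.
    by move=> nv; case: (boolP (adj u v)) => // auv; case: nv; exists u; rewrite adj_sym.
  rewrite /degree big1 // => v _; rewrite /adj_val; case: (boolP (adj u v)) => // auv.
  by move: uN; rewrite inE => /existsP[]; exists v.
have [f mf indf] := ex_maximal_matching G.
pose g (u : G) : G := odflt u [pick v | adj u v].
have adjg u : u \in N -> adj u (g u).
  by rewrite inE /g => /existsP[v auv]; case: pickP => //= /(_ v); rewrite auv.
pose L := [set u in N | f u == u].
have h1 := sminus_matching mf.
have h2 : #|L|%:R <= sminus R G.
  apply: (@sminus_stars L g) => [u v|u]; rewrite inE => /andP[uN /eqP fu].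
    by rewrite inE => /andP[_ /eqP fv]; exact: indf.
  exact: adjg.
have le2 : (#|N| <= #|L| + #|[set u | f u != u]|)%N.
  apply: leq_trans (leq_card_setU _ _); apply: subset_leq_card; apply/subsetP => u uN.
  by rewrite !inE; move: uN; rewrite inE => ->; case: eqP.
have le3 : #|N|%:R <= 3 * sminus R G.
  apply: le_trans (_ : (#|L| + #|[set u | f u != u]|)%:R <= _); first by rewrite ler_nat.
  rewrite natrD; lra.
have le4 : #|N|%:R ^+ 2 <= (3 * sminus R G) ^+ 2.
  by rewrite lerXn2r ?nnegrE // (le_trans _ le3).
have := ler0n R (num_edges G); lra.
Qed.

End NegativeSquareEnergy.
(** * Extremal graphs *)

Section CompleteGraph.
Variables (R : realType) (n : nat).

Definition complete_graph : sgraph.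
Proof.
refine (@SGraph 'I_n (fun u v => u != v) _ _).
- by move=> u v; rewrite eq_sym.
- by move=> u; rewrite eqxx.
Defined.

(** As quadratic forms [-A = I - J <= I], and [I] has squared Frobenius norm [n]. *)
Lemma sminus_complete : sminus R complete_graph <= n%:R.
Proof.
have [d [x [sG _ ->]]] := graph_spectral R complete_graph.
apply: le_trans (pos_sqr_le_frob (spectralN sG) (X := fun u v => (u == v)%:R) _) _.
  move=> y; rewrite -subr_ge0 (_ : _ - _ = (\sum_u y u) ^+ 2) ?sqr_ge0 //.
  rewrite expr2 big_distrlr /= -sumrB; apply: eq_bigr => u _.
  rewrite -sumrB; apply: eq_bigr => v _ /=.
  by case: eqP => _ /=; ring.
rewrite le_eqVlt; apply/orP; left; apply/eqP.
transitivity (\sum_(u : 'I_n) 1 : R); last by rewrite sumr_const card_ord.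
apply: eq_bigr => u _; rewrite -[RHS](sum_delta (fun=> 1) u).
by apply: eq_bigr => v _; case: eqP; rewrite ?expr1n ?expr0n ?mulr1.
Qed.

Lemma num_edges_complete : 2 * (num_edges complete_graph)%:R = n%:R * (n%:R - 1) :> R.
Proof.
rewrite -sum_deg; transitivity (\sum_(u : 'I_n) (n%:R - 1) : R); last first.
  by rewrite sumr_const card_ord mulr_natl.
apply: eq_bigr => u _.
transitivity (\sum_(v : 'I_n) (1 - (u == v)%:R * 1) : R).
  by apply: eq_bigr => v _; rewrite /adj_val /=; case: eqP => _ /=; ring.
by rewrite sumrB (sum_delta (fun=> 1)) sumr_const card_ord.
Qed.

End CompleteGraph.

(** * Graphs from two-distance codes *)

Section TwoWeightCode.
(* The words [e ^~ u], indexed by [u : T], form a code in which two distinct words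
   agree in [1] or [q + 1] coordinates; adjacency means agreeing in exactly one. *)
Variables (T I : finType) (S : finType) (e : I -> T -> S).

Definition agree u v := #|[set c | e c u == e c v]|.

Definition code_graph : sgraph.
Proof.
refine (@SGraph T (fun u v => (u != v) && (agree u v == 1)%N) _ _).
- move=> u v; rewrite eq_sym; congr (_ && (_ == _)).
  by apply: eq_card => c; rewrite !inE eq_sym.
- by move=> u; rewrite eqxx.
Defined.

Variables (R : realType) (q : nat) (A : {set S}).
Hypotheses (q2 : (2 <= q)%N) (cardT : #|T| = (q ^ 4)%N) (cardI : #|I| = (q ^ 2 + 1)%N).
Hypotheses (cardA : #|A| = q) (eA : forall c u, e c u \in A).
Hypothesis agreeE : forall u v, u != v -> agree u v = 1%N \/ agree u v = q.+1.
Hypothesis fiber : forall c s, (#|[set v | e c v == s]| <= q ^ 3)%N.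

Local Notation Q := (q%:R : R).
Local Notation M u v := ((agree u v)%:R : R).

Let q0 : 0 < Q. Proof. by rewrite ltr0n; exact: leq_trans q2. Qed.
Let qn0 : Q != 0. Proof. exact: lt0r_neq0. Qed.

(** Off the diagonal [q + 1 - M] is [q] on edges and 0 elsewhere; the identity term corrects the
    diagonal entry [q^2 + 1] of [M]. *)
Lemma agree_ker (u v : T) :
  Q * @adj_val R code_graph u v = Q * (Q - 1) * (u == v)%:R + (Q + 1) - M u v.
Proof.
rewrite /adj_val /=; have [->|uv] /= := eqVneq u v.
  have -> : agree v v = (q ^ 2 + 1)%N.
    by rewrite -cardI -cardsT; apply: eq_card => c; rewrite !inE eqxx.
  by rewrite natrD natrX; ring.
have [->|->] := agreeE uv; first by rewrite eqxx /=; ring.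
rewrite eqSS gtn_eqF; last by exact: leq_trans q2.
by rewrite -natr1 /=; ring.
Qed.

Lemma agree_sum u v : M u v = \sum_c (e c u == e c v)%:R.
Proof.
rewrite /agree -sum1_card natr_sum big_mkcond; apply: eq_bigr => c _.
by rewrite inE; case: eqP.
Qed.

(** The form of [M] is a sum, over coordinates and symbols, of squared fibre sums; apply
    Cauchy-Schwarz over the [q] symbols in each of the [q^2 + 1] coordinates. *)
Lemma quad_agree (y : T -> R) :
  (Q ^+ 2 + 1) * (\sum_u y u) ^+ 2 <= Q * quad (fun u v => M u v) y.
Proof.
have -> : quad (fun u v => M u v) y =
    \sum_c \sum_(s in A) (\sum_(u | e c u == s) y u) ^+ 2.
  rewrite /quad; under eq_bigr do under eq_bigr do rewrite agree_sum mulr_suml.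
  under eq_bigr do rewrite exchange_big.
  rewrite exchange_big /=; apply: eq_bigr => c _.
  rewrite (partition_big (e c) (mem A)) //=; apply: eq_bigr => s _.
  rewrite expr2 big_distrlr /=; apply: eq_bigr => u /eqP us.
  rewrite [RHS]big_mkcond; apply: eq_bigr => v _; rewrite us eq_sym.
  by case: eqP; rewrite ?mul1r ?mul0r.
have -> : (Q ^+ 2 + 1) * (\sum_u y u) ^+ 2 = \sum_(c : I) (\sum_u y u) ^+ 2.
  by rewrite sumr_const cardI -[RHS]mulr_natl natrD natrX.
rewrite mulr_sumr; apply: ler_sum => c _.
rewrite (partition_big (e c) (mem A)) //=.
pose f s := \sum_(u | e c u == s) y u.
have h := sumM_sqr (mem A) (fun _ => 1) f.
have e1 : \sum_(s in A) 1 * f s = \sum_(s in A) f s.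
  by apply: eq_bigr => s _; rewrite mul1r.
have e2 : \sum_(s in A) 1 ^+ 2 = Q.
  by under eq_bigr do rewrite expr1n; rewrite sumr_const cardA.
by rewrite e1 e2 in h.
Qed.

(* [X - A] is [(M - ((q^2 + 1) / q) J) / q], which [quad_agree] shows to be positive
   semidefinite. *)
Lemma splus_code : splus R code_graph <= 4 * Q ^+ 6.
Proof.
have [d [x [sG -> _]]] := graph_spectral R code_graph.
pose X (u v : T) : R := (Q - 1) * (u == v)%:R + (Q - 1) / Q ^+ 2.
apply: le_trans (pos_sqr_le_frob sG (X := X) _) _.
  move=> y; rewrite -(ler_pM2l (exprn_gt0 2 q0)) -subr_ge0.
  suff -> : Q ^+ 2 * quad X y - Q ^+ 2 * quad (@adj_val R code_graph) y =
      Q * quad (fun u v => M u v) y - (Q ^+ 2 + 1) * (\sum_u y u) ^+ 2.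
    by rewrite subr_ge0 quad_agree.
  rewrite (expr2 (\sum_u y u)) big_distrlr /= !mulr_sumr -!sumrB; apply: eq_bigr => u _.
  rewrite !mulr_sumr -!sumrB; apply: eq_bigr => v _.
  have -> : M u v = Q * (Q - 1) * (u == v)%:R + (Q + 1) - Q * @adj_val R code_graph u v.
    by rewrite agree_ker; ring.
  by rewrite /X; field.
(* The two summands of [X] have the same squared Frobenius norm [q^4 (q - 1)^2]. *)
apply: le_trans (_ : \sum_(u : T) \sum_(v : T) ((u == v)%:R * (2 * (Q - 1) ^+ 2)
    + 2 * ((Q - 1) / Q ^+ 2) ^+ 2) <= _).
  apply: ler_sum => u _; apply: ler_sum => v _; rewrite /X.
  case: eqP => _ /=; last by have := sqr_ge0 ((Q - 1) / Q ^+ 2); lra.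
  by have := sqr_ge0 ((Q - 1) - (Q - 1) / Q ^+ 2); rewrite sqrrB; lra.
under eq_bigr do rewrite big_split /= (sum_delta (fun=> 2 * (Q - 1) ^+ 2)) sumr_const cardT.
rewrite sumr_const cardT -[leLHS]mulr_natl -[X in _ + X]mulr_natl natrX.
have -> : Q ^+ 4 * (2 * (Q - 1) ^+ 2 + Q ^+ 4 * (2 * ((Q - 1) / Q ^+ 2) ^+ 2)) =
  4 * Q ^+ 4 * (Q - 1) ^+ 2 by field.
rewrite (_ : 4 * Q ^+ 6 = 4 * Q ^+ 4 * Q ^+ 2); last by ring.
rewrite ler_wpM2l ?mulr_ge0 ?exprn_ge0 // lerXn2r ?nnegrE //; last by lra.
by rewrite subr_ge0 ler1n; exact: leq_trans q2.
Qed.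

(** Counting agreeing pairs by coordinate bounds the sum of [M] by [(q^2 + 1) q^7]; summing
    [agree_ker] then gives [2 q m >= q^8 - q^7 >= q^8 / 2]. *)
Lemma num_edges_code : Q ^+ 7 <= 4 * (num_edges code_graph)%:R.
Proof.
have h : \sum_(u : T) \sum_(v : T) M u v <= (Q ^+ 2 + 1) * Q ^+ 7.
  under eq_bigr do under eq_bigr do rewrite agree_sum.
  under eq_bigr do rewrite exchange_big.
  rewrite exchange_big /=.
  apply: le_trans (_ : \sum_(c : I) Q ^+ 7 <= _); last first.
    by rewrite sumr_const cardI -[leLHS]mulr_natl natrD natrX.
  apply: ler_sum => c _.
  apply: le_trans (_ : \sum_(u : T) Q ^+ 3 <= _); last first.
    by rewrite sumr_const cardT -[leLHS]mulr_natl natrX -exprD.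
  apply: ler_sum => u _; have := fiber c (e c u); rewrite -(ler_nat R) natrX.
  apply: le_trans; rewrite -sum1_card natr_sum [leRHS]big_mkcond.
  by apply: ler_sum => v _; rewrite inE eq_sym; case: eqP.
have e1 : Q * (2 * (num_edges code_graph)%:R) =
    Q * (Q - 1) * Q ^+ 4 + (Q + 1) * Q ^+ 8 - \sum_(u : T) \sum_(v : T) M u v.
  rewrite -sum_deg mulr_sumr.
  transitivity (\sum_(u : T) (Q * (Q - 1) + (Q + 1) * Q ^+ 4 - \sum_v M u v)).
    apply: eq_bigr => u _; rewrite /degree mulr_sumr.
    under eq_bigr do rewrite agree_ker.
    rewrite sumrB big_split /=; congr (_ + _ - _); last first.
      by rewrite sumr_const cardT -[LHS]mulr_natr natrX.
    by rewrite -[RHS](sum_delta (fun=> Q * (Q - 1)) u); apply: eq_bigr => v _; rewrite mulrC.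
  by rewrite sumrB sumr_const cardT -[X in X - _]mulr_natr natrX; congr (_ - _); ring.
have Q2 : 2 <= Q by rewrite ler_nat.
rewrite -(ler_pM2l q0).
have e2 : Q * (4 * (num_edges code_graph)%:R) =
  2 * (Q * (2 * (num_edges code_graph)%:R)) by ring.
rewrite e2 e1.
have e3 : Q * Q ^+ 7 = Q ^+ 8 by ring.
have h4 : 2 * Q ^+ 7 <= Q ^+ 8 by rewrite -e3 ler_wpM2r // exprn_ge0 // ltW.
have h5 : 0 <= Q * (Q - 1) * Q ^+ 4.
  by rewrite !mulr_ge0 ?exprn_ge0 ?(ltW q0) //; lra.
have e4 : (Q ^+ 2 + 1) * Q ^+ 7 = Q * Q ^+ 8 + Q ^+ 7 by ring.
rewrite e3; rewrite e4 in h; lra.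
Qed.

End TwoWeightCode.

(** * The elliptic quadric code over the field of order [p^2] *)

Section EllipticCode.
Variables (F : finFieldType) (p : nat).
Hypotheses (pF : p \in [pchar F]) (cardF : #|F| = (p ^ 2)%N).

Let p_gt1 : (1 < p)%N. Proof. exact: prime_gt1 (pcharf_prime pF). Qed.

(** Turns root-counting upper bounds on fibres into exact sizes once the total leaves no slack. *)
Lemma card_fibers (X Y : finType) (A : {set X}) (B : {set Y}) (f : X -> Y) k :
  (forall x, x \in A -> f x \in B) ->
  (forall y, y \in B -> (#|[set x in A | f x == y]| <= k)%N) ->
  (#|A| <= #|B| * k)%N /\
  ((#|B| * k <= #|A|)%N -> forall y, y \in B -> #|[set x in A | f x == y]| = k).
Proof.
move=> fB fk.
have AE : #|A| = (\sum_(y in B) #|[set x in A | f x == y]|)%N.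
  rewrite -sum1_card (partition_big f (mem B)) //=; apply: eq_bigr => y _.
  by rewrite -sum1_card; apply: eq_bigl => x; rewrite !inE.
have le : (#|A| <= #|B| * k)%N by rewrite AE -sum_nat_const; apply: leq_sum.
split=> // ge y yB; apply/eqP; rewrite eqn_leq fk //= leqNgt; apply/negP => lt.
move: ge; rewrite leqNgt => /negP; apply.
rewrite AE -sum_nat_const (bigD1 y) //= [X in (_ < X)%N](bigD1 y) //=.
by rewrite -addSn leq_add // leq_sum // => z /andP[zB _]; exact: fk.
Qed.

Lemma card_roots_le (P : {poly F}) (A : {set F}) :
  P != 0 -> (forall z, z \in A -> root P z) -> (#|A| < size P)%N.
Proof.
move=> P0 rA; rewrite cardE; apply: max_poly_roots => //; last exact: enum_uniq.
by apply/allP => z; rewrite mem_enum; exact: rA.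
Qed.

Lemma frobD (x y : F) : (x + y) ^+ p = x ^+ p + y ^+ p.
Proof. exact: (pFrobenius_autD_comm pF (mulrC x y)). Qed.

Lemma frobN (x : F) : (- x) ^+ p = - x ^+ p.
Proof. exact: (pFrobenius_autN pF x). Qed.

Lemma frobK (x : F) : (x ^+ p) ^+ p = x.
Proof. by rewrite -exprM mulnn -cardF expf_card. Qed.

Definition fixed : {set F} := [set x | x ^+ p == x].
Definition norm (z : F) := z ^+ p.+1.
Definition trace (z : F) := z + z ^+ p.

Lemma fixedP x : reflect (x ^+ p = x) (x \in fixed).
Proof. by rewrite inE; exact: eqP. Qed.

Lemma fixed0 : 0 \in fixed.
Proof. by apply/fixedP; rewrite expr0n; case: p p_gt1. Qed.

Lemma fixedD x y : x \in fixed -> y \in fixed -> x + y \in fixed.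
Proof. by move=> /fixedP xp /fixedP yp; apply/fixedP; rewrite frobD xp yp. Qed.

Lemma fixedN x : x \in fixed -> - x \in fixed.
Proof. by move=> /fixedP xp; apply/fixedP; rewrite frobN xp. Qed.

Lemma fixedM x y : x \in fixed -> y \in fixed -> x * y \in fixed.
Proof. by move=> /fixedP xp /fixedP yp; apply/fixedP; rewrite exprMn xp yp. Qed.

Lemma fixedV x : x \in fixed -> x^-1 \in fixed.
Proof. by move=> /fixedP xp; apply/fixedP; rewrite exprVn xp. Qed.

Lemma norm_fixed z : norm z \in fixed.
Proof. by apply/fixedP; rewrite /norm exprS exprMn frobK mulrC. Qed.

Lemma trace_fixed z : trace z \in fixed.
Proof. by apply/fixedP; rewrite /trace frobD frobK addrC. Qed.

Lemma trace_fiber_le k : (#|[set z in [set: F] | trace z == k]| <= p)%N.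
Proof.
pose P : {poly F} := 'X^p + ('X - k%:P).
have sP : size P = p.+1 by rewrite size_polyDl size_polyXn // size_XsubC ltnS.
rewrite -ltnS -sP; apply: card_roots_le.
  by rewrite -size_poly_eq0 sP.
move=> z; rewrite !inE /= => /eqP zk.
by rewrite rootE /P hornerD hornerXn hornerXsubC -zk /trace addrA [X in X - _]addrC subrr.
Qed.

(** At most [p] by counting roots; at least [p] because the trace maps [p^2] elements here with
    fibres of size at most [p]. *)
Lemma card_fixed : #|fixed| = p.
Proof.
apply/eqP; rewrite eqn_leq; apply/andP; split.
  pose P : {poly F} := 'X^p - 'X.
  have sP : size P = p.+1 by rewrite size_polyDl size_polyXn // size_polyN size_polyX ltnS.
  rewrite -ltnS -sP; apply: card_roots_le.
    by rewrite -size_poly_eq0 sP.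
  by move=> z /fixedP zp; rewrite rootE /P !hornerE zp subrr.
have [le _] := @card_fibers F F [set: F] fixed trace p (fun z _ => trace_fixed z)
  (fun y _ => trace_fiber_le y).
by move: le; rewrite cardsT cardF expnS expn1 leq_pmul2r // ltnW.
Qed.

Lemma card_trace_fiber k : k \in fixed -> #|[set z | trace z == k]| = p.
Proof.
move=> kK; have [_ eq] := @card_fibers F F [set: F] fixed trace p
  (fun z _ => trace_fixed z) (fun y _ => trace_fiber_le y).
rewrite -[RHS](eq _ k kK); last by rewrite card_fixed cardsT cardF expnS expn1.
by apply: eq_card => z; rewrite !inE.
Qed.

(** The norm maps [p^2 - 1] nonzero elements to [p - 1] values with fibres of size at most [p + 1],
    so no fibre is smaller. *)
Lemma card_norm_fiber k : k \in fixed -> k != 0 -> #|[set z | norm z == k]| = p.+1.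
Proof.
move=> kK k0.
have nB z : z \in [set~ 0] -> norm z \in fixed :\ 0.
  by rewrite !inE /= => z0; rewrite expf_neq0 //=; have := norm_fixed z; rewrite inE.
have nle y : y \in fixed :\ 0 -> (#|[set z in [set~ 0%R] | norm z == y]| <= p.+1)%N.
  move=> _; have sP : size ('X^(p.+1) - y%:P : {poly F}) = p.+2 by rewrite size_XnsubC.
  rewrite -ltnS -sP; apply: card_roots_le; first by rewrite -size_poly_eq0 sP.
  by move=> z; rewrite !inE => /andP[_ /eqP <-]; rewrite rootE !hornerE subrr.
have [_ eq] := card_fibers nB nle.
have k' : k \in fixed :\ 0 by rewrite in_setD1 k0.
rewrite -[RHS](eq _ k k').
  apply: eq_card => z; rewrite !inE; case: (eqVneq z 0) => [->|] //=.
  by rewrite /norm expr0n eq_sym (negPf k0).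
have := cardsD1 0 fixed; rewrite fixed0 card_fixed add1n => pE.
rewrite cardsC1 cardF; move: #|_| pE => x ->.
by rewrite -mulnn mulSn addSn /= mulnS.
Qed.

(** Completing the square: the expression equals [a (norm (z + s) - k)], so the zeros form a
    translated norm fibre, a single point when [k = 0]. *)
Lemma card_norm_affine a b c : a \in fixed -> c \in fixed -> a != 0 ->
  let N := #|[set z | a * norm z + trace (b * z) + c == 0]| in N = 1%N \/ N = p.+1.
Proof.
move=> /fixedP aK cK a0 /=; set s := b ^+ p / a.
have sp : s ^+ p = b / a by rewrite /s expr_div_n frobK aK.
pose k := norm b / a / a - c / a.
have kK : k \in fixed.
  rewrite fixedD ?fixedN ?fixedM ?fixedV ?norm_fixed //; exact/fixedP.
have -> : #|[set z | a * norm z + trace (b * z) + c == 0]| = #|[set z | norm z == k]|.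
  rewrite -[RHS](card_preimset _ (addIr s)); apply: eq_card => z; rewrite !inE.
  rewrite -[RHS](inj_eq (mulfI a0)) -[RHS]subr_eq0; congr (_ == 0).
  rewrite /norm !exprSr frobD sp /k /norm exprSr /trace exprMn /s.
  by move: (z ^+ p) (b ^+ p) => zp bp; field.
have [->|k0] := eqVneq k 0; [left|right; exact: card_norm_fiber].
rewrite (_ : [set z | _] = [set 0]) ?cards1 //.
by apply/setP => z; rewrite !inE expf_eq0.
Qed.

Definition K := {x : F | x \in fixed}.
Definition point := (K * F * K)%type.

(* The coordinates are the points of the inversive plane on [F] and infinity, and
   [(a, b, c)] is the word of values of [a N(z) + Tr(b z) + c], with value [a] at
   infinity; the zero set of such a nonzero function is a point or a circle. *)
Definition coord (c : unit + F) (u : point) : F :=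
  match c with
  | inl _ => val u.1.1
  | inr z => val u.1.1 * norm z + trace (u.1.2 * z) + val u.2
  end.

Lemma card_K : #|{: K}| = p.
Proof. by rewrite card_sig -card_fixed; apply: eq_card. Qed.

Lemma card_point : #|{: point}| = (p ^ 4)%N.
Proof. by rewrite !card_prod card_K cardF -[X in (X * _ * X)%N]expn1 -!expnD. Qed.

Lemma coord_fixed c u : coord c u \in fixed.
Proof.
have vK (x : K) : val x \in fixed := valP x.
case: c => [t|z]; first exact: vK.
exact: fixedD (fixedD (fixedM (vK _) (norm_fixed _)) (trace_fixed _)) (vK _).
Qed.

(** Count zeros of the difference. If [a] differs, infinity is excluded and a point or circle
    remains; if only [b] and possibly [c] differ, infinity joins a trace fibre of size [p]; if only
    [c] differs, infinity alone is left. *)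
Lemma agree_coord u v : u != v -> agree coord u v = 1%N \/ agree coord u v = p.+1.
Proof.
case: u v => [[a b] c] [[a' b'] c'] uv.
pose N := #|[set z |
  (val a - val a') * norm z + trace ((b - b') * z) + (val c - val c') == 0]|.
have -> : agree coord (a, b, c) (a', b', c') = ((a == a') + N)%N.
  rewrite /agree -sum1_card big_mkcond big_sumType /=; congr (_ + _)%N.
    by rewrite (big_pred1 tt) => [|[]//]; rewrite inE /= (inj_eq val_inj); case: eqP.
  rewrite /N -sum1_card [RHS]big_mkcond; apply: eq_bigr => z _; rewrite !inE /=.
  rewrite -subr_eq0 (_ : _ - _ = (val a - val a') * norm z + trace ((b - b') * z)
     + (val c - val c')) //.
  rewrite /trace !mulrBl frobD frobN.
  by move: ((b * z) ^+ p) ((b' * z) ^+ p) => x y; rewrite -![sval _]/(val _); ring.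
have vK (x : K) : val x \in fixed by exact: valP.
have [aa|naa] := eqVneq a a'; last first.
  rewrite add0n; apply: card_norm_affine; rewrite ?fixedD ?fixedN //.
  by rewrite subr_eq0 (inj_eq val_inj).
rewrite /N aa subrr.
have [bb|nbb] := eqVneq b b'.
  left; rewrite bb subrr -[RHS]addn0; congr (_ + _)%N; apply/eqP.
  rewrite cards_eq0; apply/eqP/setP => z; rewrite !inE !mul0r /trace expr0n.
  case: p p_gt1 => // n _ /=.
  rewrite !addr0 add0r subr_eq0 (inj_eq val_inj); apply/negbTE.
  by apply: contraNneq uv => ->; rewrite aa bb.
right; rewrite add1n; congr _.+1.
have b0 : b - b' != 0 by rewrite subr_eq0.
have kK : - (val c - val c') \in fixed by rewrite fixedN ?fixedD ?fixedN.
rewrite -[RHS](card_trace_fiber kK) -[RHS](card_preimset _ (mulfI b0)).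
by apply: eq_card => z; rewrite !inE mul0r add0r addr_eq0.
Qed.

(** A prescribed value determines [a] at infinity, and determines [c] from [a] and [b] elsewhere. *)
Lemma card_coord_fiber c s : (#|[set v | coord c v == s]| <= p ^ 3)%N.
Proof.
have cFK : #|{: F * K}| = (p ^ 3)%N by rewrite card_prod card_K cardF -expnSr.
rewrite -cFK; case: c => [t|z].
  pose h (v : point) : F * K := (v.1.2, v.2).
  rewrite -(card_in_imset (f := h)) ?max_card // => -[[a b] c] [[a' b'] c'].
  rewrite !inE /= => /eqP ac /eqP a'c [-> ->].
  by do 2 congr pair; apply: val_inj; exact: etrans ac (esym a'c).
pose h (v : point) : F * K := (v.1.2, v.1.1).
rewrite -(card_in_imset (f := h)) ?max_card // => -[[a b] c] [[a' b'] c'].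
rewrite !inE /= => /eqP ac /eqP a'c [bb aa]; rewrite aa bb; congr pair; apply: val_inj.
by apply: (addrI (val a' * norm z + trace (b' * z)));
  apply: etrans (esym a'c); rewrite -ac aa bb.
Qed.

End EllipticCode.

(** * Powers of the number of edges *)

Lemma expr_powR_inv (R : realType) (x : R) (k n : nat) : 0 <= x ->
  (x `^ (n%:R)^-1) ^+ k = x `^ (k%:R / n%:R).
Proof. by move=> x0; rewrite -powR_mulrn ?powR_ge0 // -powRrM mulrC. Qed.

Lemma splus_lower (R : realType) : exists m0 : nat,
  forall G : sgraph, (m0 <= num_edges G)%N ->
  let m : R := (num_edges G)%:R in
  1 / 100 * ((m `^ (6 / 7)) / (ln (ln m) `^ (8 / 3))) <= splus R G.
Proof.
(* From [e^e] on, [ln (ln m) >= 1], so the logarithmic denominator only weakens the bound. *)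
exists (Num.bound (sequences.expR (sequences.expR (1 : R)))).
move=> G hm; set m : R := (num_edges G)%:R; rewrite /=.
have me : sequences.expR (sequences.expR 1) <= m.
  apply: ltW; apply: lt_le_trans (archi_boundP _) _; first exact: expR_ge0.
  by rewrite ler_nat.
have e1 (x : R) : 0 <= x -> 1 <= sequences.expR x by move=> x0; rewrite -expR0 ler_expR.
have m1 : 1 <= m by apply: le_trans me; rewrite e1 ?expR_ge0.
have m0 : 0 < m by exact: lt_le_trans m1.
have l1 : sequences.expR 1 <= ln m by rewrite -[leLHS]expRK ler_ln // posrE ?expR_gt0.
have l0 : 0 < ln m by apply: lt_le_trans l1; exact: expR_gt0.
have l2 : 1 <= ln (ln m) by rewrite -[leLHS]expRK ler_ln // posrE ?expR_gt0.
have l3 : 1 <= ln (ln m) `^ (8 / 3).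
  rewrite -[leLHS](powRr0 (ln (ln m))) ler_powR //; lra.
pose y := m `^ (28%:R)^-1.
have y1 : 1 <= y by rewrite -[leLHS](powRr0 m) ler_powR // invr_ge0.
have y28 : y ^+ 28 = m by rewrite expr_powR_inv ?(ltW m0) // divff ?pnatr_eq0 // powRr1 // ltW.
have y24 : y ^+ 24 = m `^ (6 / 7).
  by rewrite expr_powR_inv ?(ltW m0) //; congr (_ `^ _); field.
have := splus_ge_pow y1 (esym y28); rewrite y24; apply: le_trans.
rewrite mul1r mulrC ler_wpM2r ?invr_ge0 // ler_pdivrMr ?(lt_le_trans ltr01 l3) //.
by rewrite ler_peMr // powR_ge0.
Qed.

Lemma sminus_lower (R : realType) (G : sgraph) :
  1 / 100 * ((num_edges G)%:R `^ (1 / 2)) <= sminus R G.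
Proof.
have s0 : 0 <= sminus R G by apply: sumr_ge0 => x _; rewrite sqr_ge0.
have : Num.sqrt (num_edges G)%:R <= 3 * sminus R G.
  rewrite -[leRHS]ger0_norm ?mulr_ge0 // -sqrtr_sqr.
  exact/ler_wsqrtr/num_edges_le_sminus.
rewrite (_ : 1 / 2 = 2^-1); last by rewrite mul1r.
by rewrite powR12_sqrt ?ler0n //; lra.
Qed.

Lemma splus_upper (R : realType) (N : nat) : exists G : sgraph,
  (N <= num_edges G)%N /\ splus R G <= 16 * (num_edges G)%:R `^ (6 / 7).
Proof.
(* Then [4 N < p <= p^7 <= 4 m]. *)
have [p pN pP] := prime_above (4 * N).
have [F pF cF] := @pPrimePowerField p 2 pP isT.
have p2 : (2 <= p)%N := prime_gt1 pP.
pose T : finType := point F p; pose I : finType := (unit + F)%type.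
have cI : #|{: I}| = (p ^ 2 + 1)%N by rewrite card_sum card_unit cF addnC.
have cT : #|{: T}| = (p ^ 4)%N := card_point pF cF.
have agr := agree_coord pF cF.
have fb := card_coord_fiber pF cF.
have cA := card_fixed pF cF.
have eA := coord_fixed pF cF.
pose G := code_graph (@coord F p); exists G.
have mE : p%:R ^+ 7 <= 4 * (num_edges G)%:R :> R by exact: num_edges_code agr fb.
have sE : splus R G <= 4 * p%:R ^+ 6 by exact: splus_code eA agr.
split.
  move: mE; rewrite -natrX -natrM ler_nat => h.
  rewrite -(leq_pmul2l (_ : 0 < 4)%N) //; apply: leq_trans (leq_trans (ltnW pN) _) h.
  by rewrite -[X in (X <= _)%N]expn1 leq_exp2l.
apply: le_trans sE _.
have q0 : 0 <= p%:R :> R by [].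
have -> : (p%:R : R) ^+ 6 = (p%:R ^+ 7) `^ (6 / 7).
  by rewrite -!powR_mulrn // -powRrM; congr (_ `^ _); field.
(* The constant 16 arises from [4 * 4^(6/7) <= 4 * 4]. *)
apply: le_trans (_ : 4 * (4 * (num_edges G)%:R) `^ (6 / 7) <= _).
  by rewrite ler_pM2l // ge0_ler_powR ?nnegrE ?exprn_ge0 ?mulr_ge0 //; lra.
rewrite powRM // mulrA ler_wpM2r ?powR_ge0 //.
rewrite (_ : 16 = 4 * 4); last by ring.
rewrite ler_pM2l // -[leRHS](powRr1 (_ : 0 <= 4)) // ler_powR //; lra.
Qed.

Lemma sminus_upper (R : realType) (N : nat) : exists G : sgraph,
  (N <= num_edges G)%N /\ sminus R G <= 16 * (num_edges G)%:R `^ (1 / 2).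
Proof.
(* With [n >= 2] vertices, [n^2 <= 2 n (n - 1) = 4 m]. *)
exists (complete_graph N.+2).
have e := num_edges_complete R N.+2; have s := sminus_complete R N.+2.
set m := num_edges _ in e *.
have n2 : (N.+2)%:R = N%:R + 2 :> R by rewrite -addn2 natrD.
have N0 : 0 <= N%:R :> R by [].
split; first by rewrite -(ler_nat R); rewrite n2 in e; nra.
apply: le_trans s _; rewrite (_ : 1 / 2 = 2^-1); last by rewrite mul1r.
rewrite powR12_sqrt ?ler0n // -[leRHS]ger0_norm ?mulr_ge0 ?sqrtr_ge0 //.
rewrite -[leLHS]ger0_norm // -ler_sqr ?nnegrE // !real_normK ?num_real //.
by rewrite exprMn sqr_sqrtr ?ler0n //; rewrite n2 in e *; nra.
Qed.

Theorem theorem1p13 (R : realType) :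
  (exists c : R, 0 < c /\ exists m0 : nat,
     forall G : sgraph, (m0 <= num_edges G)%N ->
       let m : R := (num_edges G)%:R in
       c * ((m `^ (6 / 7)) / (ln (ln m) `^ (8 / 3))) <= splus R G /\
       c * (m `^ (1 / 2)) <= sminus R G)
  /\
  (exists C : R,
     (forall M : nat, exists G : sgraph,
        (M <= num_edges G)%N /\
        splus R G <= C * (num_edges G)%:R `^ (6 / 7)) /\
     (forall M : nat, exists G : sgraph,
        (M <= num_edges G)%N /\
        sminus R G <= C * (num_edges G)%:R `^ (1 / 2))).
Proof.
split.
  exists (1 / 100); split; first by lra.
  have [m0 hs] := splus_lower R; exists m0.
  move=> G hm m.
  by split; [exact: hs|exact: sminus_lower].
by exists 16; split=> N; [exact: splus_upper|exact: sminus_upper].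
Qed.
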